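(* Let $H,K,E$ be Hilbert $\mathfrak{A}$-modules over a $C^*$-algebra $\mathfrak{A}$, and let $A\in\mathcal{L}(H,K)$ and $B\in\mathcal{L}(H,E)$ be such that $A$ and $A^*A+B^*B$ are both M-P invertible. Let $V\in\mathcal{L}(K)$ and $W,W'\in\mathcal{L}(E)$ be arbitrary positive definite operators, and let $B=B_1+B_2$ with $B_1,B_2\in\mathcal{L}(H,E)$ be the unique decomposition such that (i) $B_2^*WB_1=0$ and $\mathcal{R}(B_1^* )\subseteq\mathcal{R}(A^* )$; (ii) $\big(\mathcal{R}(A^* ),\mathcal{R}(B_2^* )\big)$ is a separated pair. Then $$\lim_{t\to 0^+}\left(A^*VA+tB^*WB\right)^{\dag}A^*V=\left(A^*VA+B_2^*W'B_2\right)^{\dag}A^*V=(A^*VA)^\dag A^*V-(I_H-A^\dag A)\Pi'$$ in the operator-norm topology, where $\Pi'\in\mathcal{L}(K,H)$ is given by $$\Pi'=(2I_H-A^\dag A-B_2^\dag B_2)^{-1}(A^*VA)^\dag A^*V.$$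
   Context: $\mathcal{L}(H,K)$ is the set of adjointable operators from $H$ to $K$, $\mathcal{L}(H)=\mathcal{L}(H,H)$, $I_H$ is the identity operator on $H$, and $\mathcal{R}(\cdot)$ denotes range. A positive definite operator on $K$ is a positive operator in $\mathcal{L}(K)$ that is invertible in $\mathcal{L}(K)$. $T^\dag$ denotes the Moore-Penrose inverse of an adjointable operator $T$: the unique adjointable $X$ (if it exists) with $TXT=T$, $XTX=X$, $(TX)^*=TX$, $(XT)^*=XT$; it exists iff $\mathcal{R}(T)$ is closed, in which case $T$ is called M-P invertible. For $C\in\mathcal{L}(H,E)$, the pair $\big(\mathcal{R}(A^* ),\mathcal{R}(C^* )\big)$ is called a separated pair if $\mathcal{R}(A^* )\cap\mathcal{R}(C^* )=\{0\}$ and $\mathcal{R}(A^* )+\mathcal{R}(C^* )$ is closed in $H$; in that case $A$ and $C$ are M-P invertible and $2I_H-A^\dag A-C^\dag C$ is invertible in $\mathcal{L}(H)$. Under the hypotheses of the claim, a decomposition $B=B_1+B_2$ satisfying (i) and (ii) exists and is unique. *)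

(* Defs.v *)
From HB Require Import structures.
From mathcomp Require Import all_boot all_order all_algebra.
From mathcomp Require Import all_classical all_reals all_analysis.
From mathcomp Require Import complex.

Set Implicit Arguments.
Unset Strict Implicit.
Unset Printing Implicit Defensive.

Import Order.TTheory GRing.Theory Num.Theory.
Import numFieldNormedType.Exports.

Local Open Scope classical_set_scope.
Local Open Scope ring_scope.
Local Open Scope complex_scope.

(** C*-algebras need not have a unit, so the product cannot come from the
    (unital) ring structures of MathComp. *)

HB.mixin Record isCStarAlgebra (R : realType) T
    of CompleteNormedModule R[i] T := {
  cmul : T -> T -> T;
  cstar : T -> T;
  cmulA : forall a b c, cmul a (cmul b c) = cmul (cmul a b) c;
  cmulDl : forall a b c, cmul (a + b) c = cmul a c + cmul b c;
  cmulDr : forall a b c, cmul a (b + c) = cmul a b + cmul a c;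
  cmulZl : forall (k : R[i]) a b, cmul (k *: a) b = k *: cmul a b;
  cmulZr : forall (k : R[i]) a b, cmul a (k *: b) = k *: cmul a b;
  cstarD : forall a b, cstar (a + b) = cstar a + cstar b;
  cstarZ : forall (k : R[i]) a, cstar (k *: a) = k^* *: cstar a;
  cstarM : forall a b, cstar (cmul a b) = cmul (cstar b) (cstar a);
  cstarK : forall a, cstar (cstar a) = a;
  cmul_norm : forall a b, `|cmul a b| <= `|a| * `|b|;
  cstar_norm : forall a, `|cmul (cstar a) a| = `|a| ^+ 2
}.

#[short(type="cstarAlgType")]
HB.structure Definition CStarAlgebra (R : realType) :=
  {T of isCStarAlgebra R T & CompleteNormedModule R[i] T}.

Definition cpositive (R : realType) (Alg : cstarAlgType R) (a : Alg) : Prop :=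
  exists b : Alg, a = cmul (cstar b) b.

(** Right Hilbert modules; the inner product is linear in its second variable.
    Completeness of [T] is with respect to the norm in [inner_norm]. *)

HB.mixin Record isHilbertModule (R : realType) (Alg : cstarAlgType R) T
    of CompleteNormedModule R[i] T := {
  ract : T -> Alg -> T;
  inner : T -> T -> Alg;
  ractA : forall x a b, ract x (cmul a b) = ract (ract x a) b;
  ractDl : forall x y a, ract (x + y) a = ract x a + ract y a;
  ractDr : forall x a b, ract x (a + b) = ract x a + ract x b;
  ractZl : forall (k : R[i]) x a, ract (k *: x) a = k *: ract x a;
  ractZr : forall (k : R[i]) x a, ract x (k *: a) = k *: ract x a;
  innerDr : forall x y z, inner x (y + z) = inner x y + inner x z;
  innerZr : forall (k : R[i]) x y, inner x (k *: y) = k *: inner x y;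
  inner_ract : forall x y a, inner x (ract y a) = cmul (inner x y) a;
  inner_star : forall x y, cstar (inner x y) = inner y x;
  inner_pos : forall x, cpositive (inner x x);
  inner_def : forall x, inner x x = 0 -> x = 0;
  inner_norm : forall x, `|x| ^+ 2 = `|inner x x|
}.

#[short(type="hilbertModType")]
HB.structure Definition HilbertModule (R : realType) (Alg : cstarAlgType R) :=
  {T of isHilbertModule R Alg T & CompleteNormedModule R[i] T}.

Section InnerTheory.
Variables (R : realType) (Alg : cstarAlgType R) (H : hilbertModType Alg).
Implicit Types x y z : H.

Lemma innerDl x y z : inner (x + y) z = inner x z + inner y z.
Proof. by rewrite -inner_star innerDr cstarD !inner_star. Qed.

Lemma innerZl (k : R[i]) x y : inner (k *: x) y = k^* *: inner x y.
Proof. by rewrite -inner_star innerZr cstarZ inner_star. Qed.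

Lemma inner0r x : inner x 0 = 0.
Proof. by rewrite -(scale0r 0) innerZr scale0r. Qed.

Lemma inner0l x : inner 0 x = 0.
Proof. by rewrite -(scale0r 0) innerZl rmorph0 scale0r. Qed.

Lemma innerNr x y : inner x (- y) = - inner x y.
Proof. by rewrite -scaleN1r innerZr scaleN1r. Qed.

Lemma innerNl x y : inner (- x) y = - inner x y.
Proof. by rewrite -inner_star innerNr -scaleN1r cstarZ inner_star rmorphN1 scaleN1r. Qed.

Lemma inner_ext x y : (forall z, inner z x = inner z y) -> x = y.
Proof.
move=> xy; apply/eqP; rewrite -subr_eq0; apply/eqP/inner_def.
by rewrite innerDr innerNr xy subrr.
Qed.

End InnerTheory.

(** An adjointable operator is packaged with its adjoint; since the adjoint is
    unique, operators are determined by their underlying function ([adjopP]).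
    Linearity over [R[i]] and [Alg] and boundedness are consequences. *)

Section Adjointable.
Variables (R : realType) (Alg : cstarAlgType R).

Definition is_adjoint (H K : hilbertModType Alg) (T : H -> K) (S : K -> H) :=
  forall x y, inner (T x) y = inner x (S y).

Record adjop (H K : hilbertModType Alg) := AdjOp {
  adjop_fun :> H -> K;
  adjop_adj : K -> H;
  adjopE : is_adjoint adjop_fun adjop_adj
}.

HB.instance Definition _ (H K : hilbertModType Alg) :=
  gen_eqMixin (adjop H K).
HB.instance Definition _ (H K : hilbertModType Alg) :=
  gen_choiceMixin (adjop H K).

Lemma adjopP (H K : hilbertModType Alg) (T S : adjop H K) :
  (T : H -> K) =1 S -> T = S.
Proof.
case: T S => [T T' hT] [S S' hS] /= /funext TS; move: hT; rewrite {T}TS => hT.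
have E : T' = S'.
  by apply/funext => y; apply: inner_ext => z; rewrite -hT -hS.
by move: hT; rewrite E => hT; congr AdjOp; apply: Prop_irrelevance.
Qed.

Section Module.
Variables H K : hilbertModType Alg.
Implicit Types T S : adjop H K.

Fact adjop0_subproof : is_adjoint (fun _ : H => 0 : K) (fun _ => 0).
Proof. by move=> x y; rewrite inner0l inner0r. Qed.
Definition adjop0 := AdjOp adjop0_subproof.

Fact adjopD_subproof T S :
  is_adjoint (fun x => T x + S x) (fun y => adjop_adj T y + adjop_adj S y).
Proof. by move=> x y; rewrite innerDl innerDr !adjopE. Qed.
Definition adjopD T S := AdjOp (adjopD_subproof T S).

Fact adjopN_subproof T : is_adjoint (fun x => - T x) (fun y => - adjop_adj T y).
Proof. by move=> x y; rewrite innerNl innerNr adjopE. Qed.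
Definition adjopN T := AdjOp (adjopN_subproof T).

Fact adjopZ_subproof (k : R[i]) T :
  is_adjoint (fun x => k *: T x) (fun y => k^* *: adjop_adj T y).
Proof. by move=> x y; rewrite innerZl innerZr adjopE. Qed.
Definition adjopZ k T := AdjOp (adjopZ_subproof k T).

Fact adjopDA : associative adjopD.
Proof. by move=> T S U; apply: adjopP => x /=; rewrite addrA. Qed.
Fact adjopDC : commutative adjopD.
Proof. by move=> T S; apply: adjopP => x /=; rewrite addrC. Qed.
Fact adjop0D : left_id adjop0 adjopD.
Proof. by move=> T; apply: adjopP => x /=; rewrite add0r. Qed.
Fact adjopND : left_inverse adjop0 adjopN adjopD.
Proof. by move=> T; apply: adjopP => x /=; rewrite addNr. Qed.

HB.instance Definition _ :=
  GRing.isZmodule.Build (adjop H K) adjopDA adjopDC adjop0D adjopND.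

Fact adjopZA (a b : R[i]) T : adjopZ a (adjopZ b T) = adjopZ (a * b) T.
Proof. by apply: adjopP => x /=; rewrite scalerA. Qed.
Fact adjop1Z : left_id 1 adjopZ.
Proof. by move=> T; apply: adjopP => x /=; rewrite scale1r. Qed.
Fact adjopZDr : right_distributive adjopZ +%R.
Proof. by move=> a T S; apply: adjopP => x /=; rewrite scalerDr. Qed.
Fact adjopZDl T : {morph adjopZ^~ T : a b / a + b}.
Proof. by move=> a b; apply: adjopP => x /=; rewrite scalerDl. Qed.

HB.instance Definition _ :=
  GRing.Zmodule_isLmodule.Build R[i] (adjop H K)
    adjopZA adjop1Z adjopZDr adjopZDl.

End Module.

Fact adj_subproof (H K : hilbertModType Alg) (T : adjop H K) :
  is_adjoint (adjop_adj T) T.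
Proof. by move=> y x; rewrite -inner_star -adjopE inner_star. Qed.
Definition adj (H K : hilbertModType Alg) (T : adjop H K) : adjop K H :=
  AdjOp (adj_subproof T).

Fact opid_subproof (H : hilbertModType Alg) : is_adjoint (@id H) (@id H).
Proof. by []. Qed.
Definition opid (H : hilbertModType Alg) : adjop H H :=
  AdjOp (@opid_subproof H).

Fact opcomp_subproof (H K E : hilbertModType Alg)
    (T : adjop K E) (S : adjop H K) :
  is_adjoint (T \o S) (adj S \o adj T).
Proof. by move=> x y /=; rewrite !adjopE. Qed.
Definition opcomp (H K E : hilbertModType Alg)
    (T : adjop K E) (S : adjop H K) : adjop H E :=
  AdjOp (opcomp_subproof T S).

End Adjointable.

Arguments opid {R Alg} H.

Declare Scope adjop_scope.
Delimit Scope adjop_scope with op.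
Bind Scope adjop_scope with adjop.
Notation "''L' ( H , K )" := (adjop H K)
  (at level 8, format "''L' ( H ,  K )") : type_scope.
Notation "''L' ( H )" := (adjop H H)
  (at level 8, format "''L' ( H )") : type_scope.
Notation "T ^*" := (adj T) : adjop_scope.
Notation "T * S" := (opcomp T S) : adjop_scope.
Notation "T + S" := (Algebra.add T%op S%op) : adjop_scope.
Notation "T - S" := (Algebra.add T%op (Algebra.opp S%op)) : adjop_scope.
Notation "k *: T" := (GRing.scale k%R T%op) : adjop_scope.

Section Operators.
Variables (R : realType) (Alg : cstarAlgType R).

Definition opnorm (H K : hilbertModType Alg) (T : 'L(H, K)) : \bar R :=
  ereal_sup [set (complex.Re `|T x|)%:E | x in [set x : H | `|x| <= 1]].

Definition is_opinv (H : hilbertModType Alg) (T X : 'L(H)) :=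
  (X * T)%op = opid H /\ (T * X)%op = opid H.

Definition op_invertible (H : hilbertModType Alg) (T : 'L(H)) :=
  exists X, is_opinv T X.

(** [0] when [T] is not invertible. *)
Definition opinv (H : hilbertModType Alg) (T : 'L(H)) : 'L(H) :=
  xget 0 [set X | is_opinv T X].

(** Positivity in the C*-algebra 'L(H), as in [cpositive]. *)
Definition op_positive (H : hilbertModType Alg) (T : 'L(H)) :=
  exists S : 'L(H), T = (S^* * S)%op.

Definition op_posdef (H : hilbertModType Alg) (T : 'L(H)) :=
  op_positive T /\ op_invertible T.

Definition is_mpinv (H K : hilbertModType Alg) (T : 'L(H, K)) (X : 'L(K, H)) :=
  [/\ (T * X * T)%op = T, (X * T * X)%op = X,
      ((T * X)^*)%op = (T * X)%op & ((X * T)^*)%op = (X * T)%op].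

Definition mp_invertible (H K : hilbertModType Alg) (T : 'L(H, K)) :=
  exists X, is_mpinv T X.

(** [0] when [T] is not M-P invertible. *)
Definition mpinv (H K : hilbertModType Alg) (T : 'L(H, K)) : 'L(K, H) :=
  xget 0 [set X | is_mpinv T X].

Definition separated_pair (H : hilbertModType Alg) (M N : set H) :=
  M `&` N = [set 0] /\ closed [set x + y | x in M & y in N].

End Operators.

Notation "T ^†" := (mpinv T)
  (at level 1, left associativity, format "T ^†") : adjop_scope.
Notation "T ^-1" := (opinv T) : adjop_scope.

(* Main.v *)
(** Positivity of [a^* a] is the only fact about C*-algebras that is needed. It is
    proved in the algebra of adjointable operators on a Hilbert module, bounded by
    the uniform boundedness principle, with Kaplansky's trick: if [r] is the
    inverse of [1 + x^* x], then [(1/2 - r)^2] and a sum of squares add up to [1],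
    which bounds [r]; decreasing [l] geometrically, [x^* x + l] then stays positive
    and invertible for all [l > 0]. Applied to multiplication operators, it gives
    [|a| <= |a + b|] for positive [a], [b] in the C*-algebra. Hence a self-adjoint
    [G] with [<x, G x>] positive of norm at least [c |x|^2] is invertible, since
    the inverse of [l + G] stays bounded while [l] decreases to [0]. All M-P
    inverses are obtained in this way, by adding to an operator the projection
    onto its kernel.

    Both [A^*VA + t B^*WB] and [G = A^*VA + B2^*W'B2] have support projection
    [N] onto [R(A^* ) + R(B^* )]. The operator [Z] given by the last formula
    satisfies [A^*VAZ = A^*V], [B2 Z = 0] and [NZ = Z], so that
    [Z = G^† A^*V]. The difference [D] between the value at [t] and [Z] solves
    [(A^*VA + t B^*WB) D = - t R] with [R(R)] contained in [R(A^* )]; pairing with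
    [D] gives [|AD| = O(t)] and [|BD| = O(sqrt t)], and these two control [D]. *)
Require Import Defs.
From HB Require Import structures.
From mathcomp Require Import all_boot all_order all_algebra.
From mathcomp Require Import all_classical all_reals all_analysis.
From mathcomp Require Import complex.
From mathcomp Require Import ring lra.

Set Implicit Arguments.
Unset Strict Implicit.
Unset Printing Implicit Defensive.

Import Order.TTheory GRing.Theory Num.Theory.
Import numFieldNormedType.Exports.

Local Open Scope classical_set_scope.
Local Open Scope ring_scope.
Local Open Scope complex_scope.

(* Norms over [R[i]] take values in [R[i]]; [nrm] reads them in [R]. *)
Definition nrm (R : realType) (V : normedModType R[i]) (x : V) : R :=
  complex.Re `|x|.

Section RealNorm.
Variables (R : realType) (V : normedModType R[i]).
Implicit Types (x y : V) (t : R).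

Lemma nrmC x : `|x| = (nrm x)%:C.
Proof. by rewrite /nrm RRe_real // ger0_real. Qed.

Lemma nrm_ge0 x : 0 <= nrm x.
Proof. by rewrite -ler0c -nrmC. Qed.

Lemma nrmD x y : nrm (x + y) <= nrm x + nrm y.
Proof. by rewrite -lecR rmorphD /= -!nrmC ler_normD. Qed.

Lemma nrmN x : nrm (- x) = nrm x.
Proof. by rewrite /nrm normrN. Qed.

Lemma nrmB x y : nrm (x - y) <= nrm x + nrm y.
Proof. by rewrite -(nrmN y) nrmD. Qed.

Lemma nrm0 : nrm (0 : V) = 0.
Proof. by rewrite /nrm normr0. Qed.

Lemma nrm_eq0 x : nrm x = 0 -> x = 0.
Proof. by move=> h; apply/eqP; rewrite -normr_eq0 nrmC h. Qed.

Lemma nrmZ (k : R[i]) x : nrm (k *: x) = complex.Re `|k| * nrm x.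
Proof.
apply: complexI; rewrite -nrmC normrZ rmorphM /= -nrmC.
by rewrite normc_def /=; case: k.
Qed.

Lemma nrmZr t x : 0 <= t -> nrm (t%:C *: x) = t * nrm x.
Proof. by move=> t0; rewrite nrmZ ger0_norm ?ler0c. Qed.

Lemma nrmZi x : nrm ('i *: x) = nrm x.
Proof. by rewrite nrmZ normc_def /= expr0n expr1n add0r sqrtr1 mul1r. Qed.

Lemma nrm_unit x : 0 < nrm x -> nrm ((nrm x)^-1%:C *: x) = 1.
Proof. by move=> h; rewrite nrmZr ?invr_ge0 ?ltW // mulVf // gt_eqF. Qed.

End RealNorm.

(** * Limits with geometric rates *)

Lemma le_of_le_add_eps (R : realType) (a b : R) :
  (forall e, 0 < e -> a <= b + e) -> a <= b.
Proof. by move=> h; apply/ler_addgt0Pr. Qed.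

Lemma le0_of_le_geometric (R : realType) (a c q : R) :
  0 <= q < 1 -> (forall n, a <= c * q ^+ n) -> a <= 0.
Proof.
move=> /andP[q0 q1] h.
have /cvgr_to_ge : geometric c q @ \oo --> 0 by apply: cvg_geometric; rewrite ger0_norm.
by apply; apply: nearW.
Qed.

(** Increments telescope to a finite geometric sum. Keeping the rate explicit reduces identities
    between limits to [le0_of_le_geometric]. *)
Lemma geometric_complete (R : realType) (V : completeNormedModType R[i])
    (u : nat -> V) (c q : R) : 0 <= q < 1 ->
  (forall n, nrm (u n.+1 - u n) <= c * q ^+ n) ->
  exists l, forall n, nrm (l - u n) <= c * q ^+ n / (1 - q).
Proof.
move=> /andP[q0 q1] hu.
have q1' : 0 < 1 - q by rewrite subr_gt0.
have c0 : 0 <= c.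
  by have := hu 0; rewrite expr0 mulr1; apply: le_trans; exact: nrm_ge0.
have D n m : nrm (u (n + m)%N - u n) <= c * q ^+ n * ((1 - q ^+ m) / (1 - q)).
  elim: m => [|m ih]; first by rewrite addn0 subrr nrm0 expr0 [1 - 1]subrr mul0r mulr0.
  have -> : u (n + m.+1)%N - u n = (u (n + m)%N.+1 - u (n + m)%N) + (u (n + m)%N - u n).
    by rewrite addnS addrA subrK.
  apply: le_trans (nrmD _ _) _; apply: le_trans (lerD (hu _) ih) _.
  rewrite exprD exprS le_eqVlt; apply/orP; left; apply/eqP.
  by field; rewrite gt_eqF.
have D' n m : nrm (u (n + m)%N - u n) <= c * q ^+ n / (1 - q).
  apply: le_trans (D n m) _; rewrite ler_wpM2l ?mulr_ge0 ?exprn_ge0 //.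
  rewrite ler_pdivrMr // mulVf ?gt_eqF // lerBlDr lerDl exprn_ge0 //.
have small e : 0 < e -> exists n, c * q ^+ n / (1 - q) < e.
  move=> e0; apply: contrapT => /forallNP h.
  have : e <= 0; last by rewrite leNgt e0.
  apply: (@le0_of_le_geometric _ _ (c / (1 - q)) q); first by rewrite q0.
  by move=> n; rewrite mulrAC leNgt; apply/negP/h.
have : cvg (u @ \oo).
  apply/cauchy_cvgP/cauchy_exP => e e0.
  have e0' : 0 < complex.Re e by move: e0; rewrite ltcE => /andP[].
  have [n hn] := small _ e0'.
  exists (u n), n => // m /= nm; rewrite -ball_normE /= distrC nrmC -(subnKC nm).
  rewrite -(@RRe_real _ e) ?gtr0_real // ltcR.
  exact: le_lt_trans (D' _ _) hn.
move=> /cvg_ex[l hl]; exists l => n; apply: le_of_le_add_eps => e e0.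
have eC : 0 < e%:C by rewrite ltcR.
move/cvgrPdist_lt: hl => /(_ _ eC)[N _ hN].
have := hN (n + N)%N; rewrite /= leq_addl nrmC ltcR => /(_ isT)/ltW h.
have -> : l - u n = (l - u (n + N)%N) + (u (n + N)%N - u n) by rewrite addrA subrK.
by apply: le_trans (nrmD _ _) _; rewrite [leRHS]addrC lerD.
Qed.

Lemma conj_realC (R : realType) (t : R) : Num.conj t%:C = t%:C :> R[i].
Proof. exact: conjc_real. Qed.

(** * Hilbert modules and bounded operators *)

Section HilbertModuleTheory.
Variables (R : realType) (Alg : cstarAlgType R) (H : hilbertModType Alg).
Implicit Types (x y z : H) (t : R).

Lemma nrm_inner x : nrm (inner x x) = nrm x ^+ 2.
Proof. by apply: complexI; rewrite rmorphXn /= -!nrmC inner_norm. Qed.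

Lemma innerBl x y z : inner (x - y) z = inner x z - inner y z.
Proof. by rewrite innerDl innerNl. Qed.

Lemma innerBr x y z : inner x (y - z) = inner x y - inner x z.
Proof. by rewrite innerDr innerNr. Qed.

Lemma inner_polarization_re x y :
  inner (x + y) (x + y) - inner (x - y) (x - y) =
  2%:R *: (inner x y + inner y x).
Proof.
rewrite !(innerDl, innerDr, innerNl, innerNr) scaler_nat mulr2n.
set a := inner x x; set b := inner x y; set c := inner y x; set d := inner y y.
rewrite !opprD !opprK (AC ((2*2)*(2*2)) (((1*5)*(4*8))*((2*3)*(6*7)))) /=.
by rewrite !subrr !add0r.
Qed.

(** The first difference is twice <x,y> + <y,x>. As [inner] is conjugate linear on the left, the
    second one, times -i, is twice <x,y> - <y,x>. *)
Lemma inner_polarization x y : 4%:R *: inner x y =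
  (inner (x + y) (x + y) - inner (x - y) (x - y))
  - 'i *: (inner (x + 'i *: y) (x + 'i *: y) - inner (x - 'i *: y) (x - 'i *: y)).
Proof.
rewrite !inner_polarization_re innerZr innerZl.
rewrite [X in _ - X]scalerA (mulrC 'i) -scalerA -scalerBr [X in _ - X]scalerDr.
rewrite [in X in _ - X]scalerA [in X in _ - X]scalerA.
have -> : 'i * 'i = -1 :> R[i] by rewrite -expr2 sqr_i.
have -> : 'i * 'i^* = 1 :> R[i] by apply/eqP; rewrite eq_complex; simpc.
rewrite scaleN1r scale1r opprD opprK addrACA subrr addr0.
by rewrite -mulr2n -[inner x y *+ 2]scaler_nat scalerA -natrM.
Qed.

(* Cauchy-Schwarz, with a worse constant: it comes from polarization alone and
   needs no positivity in [Alg]. *)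
Lemma nrm_inner_le x y : nrm (inner x y) <= 4 * nrm x * nrm y.
Proof.
have key (u v : H) : nrm u = 1 -> nrm v = 1 -> nrm (inner u v) <= 4.
  move=> u1 v1.
  have B (w : H) : nrm w <= 2 -> nrm (inner w w) <= 4.
    move=> hw; rewrite nrm_inner; have := nrm_ge0 w; nra.
  have Bp (w : H) : nrm w = 1 -> nrm (inner (u + w) (u + w)) <= 4.
    by move=> w1; apply: B; apply: le_trans (nrmD _ _) _; rewrite u1 w1; lra.
  have Bm (w : H) : nrm w = 1 -> nrm (inner (u - w) (u - w)) <= 4.
    by move=> w1; apply: B; apply: le_trans (nrmB _ _) _; rewrite u1 w1; lra.
  have i1 : nrm ('i *: v) = 1 by rewrite nrmZi.
  have := congr1 (@nrm _ _) (inner_polarization u v).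
  have -> : (4%:R : R[i]) = (4%:R : R)%:C by rewrite rmorph_nat.
  rewrite nrmZr // => E.
  (* Each of the four terms is [inner w w] with [nrm w <= 2]. *)
  have h4 : 4 * nrm (inner u v) <= 4 + 4 + 4 + 4.
    rewrite E; apply: le_trans (nrmB _ _) _; rewrite nrmZi -addrA lerD //.
      by apply: le_trans (nrmB _ _) _; apply: lerD; [apply: Bp|apply: Bm].
    by apply: le_trans (nrmB _ _) _; apply: lerD; [apply: Bp|apply: Bm].
  by lra.
have := nrm_ge0 x; rewrite le_eqVlt => /predU1P[x0|x0].
  by rewrite (nrm_eq0 (esym x0)) inner0l !nrm0 mulr0 mul0r.
have := nrm_ge0 y; rewrite le_eqVlt => /predU1P[y0|y0].
  by rewrite (nrm_eq0 (esym y0)) inner0r !nrm0 mulr0.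
have := key _ _ (nrm_unit x0) (nrm_unit y0).
rewrite innerZl innerZr conj_realC scalerA -rmorphM /= nrmZr; last first.
  by rewrite mulr_ge0 ?invr_ge0 ?ltW.
by rewrite -invfM ler_pdivrMl ?mulr_gt0 // => /le_trans; apply; lra.
Qed.

End HilbertModuleTheory.

Section Bounded.
Variables (R : realType) (Alg : cstarAlgType R).
Implicit Types (H K E : hilbertModType Alg).

Section Linear.
Variables (H K : hilbertModType Alg) (T : 'L(H, K)).

Lemma opD x y : T (x + y) = T x + T y.
Proof.
apply: inner_ext => z; rewrite innerDr -!(inner_star _ z) !adjopE.
by rewrite -cstarD -innerDl.
Qed.

Lemma opZ (k : R[i]) x : T (k *: x) = k *: T x.
Proof.
apply: inner_ext => z; rewrite innerZr -!(inner_star _ z) !adjopE.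
by rewrite innerZl cstarZ conjCK.
Qed.

Lemma op0 : T 0 = 0.
Proof. by rewrite -(scale0r 0) opZ scale0r. Qed.

Lemma opN x : T (- x) = - T x.
Proof. by rewrite -scaleN1r opZ scaleN1r. Qed.

Lemma opB x y : T (x - y) = T x - T y.
Proof. by rewrite opD opN. Qed.

Lemma adjK : ((T^*)^*)%op = T.
Proof. exact: adjopP. Qed.

Lemma inner_adjr x y : inner x (T y) = inner ((T^*)%op x) y.
Proof. by rewrite -inner_star adjopE inner_star. Qed.

End Linear.

(** A predicate with a real constant avoids suprema in the extended reals; [opnorm_le] converts it
    to [opnorm] at the very end. *)
Definition bdd (H K : hilbertModType Alg) (T : 'L(H, K)) (M : R) :=
  forall x, nrm (T x) <= M * nrm x.

Lemma bdd_le H K (T : 'L(H, K)) M N : bdd T M -> M <= N -> bdd T N.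
Proof.
by move=> hT MN x; apply: le_trans (hT x) _; rewrite ler_wpM2r ?nrm_ge0.
Qed.

Lemma bddD H K (T S : 'L(H, K)) M N : bdd T M -> bdd S N -> bdd (T + S) (M + N).
Proof.
by move=> hT hS x; apply: le_trans (nrmD _ _) _; rewrite mulrDl lerD.
Qed.

Lemma bddN H K (T : 'L(H, K)) M : bdd T M -> bdd (- T) M.
Proof. by move=> hT x; rewrite nrmN. Qed.

Lemma bddM H K E (T : 'L(K, E)) (S : 'L(H, K)) M N :
  0 <= M -> bdd T M -> bdd S N -> bdd (T * S)%op (M * N).
Proof.
move=> M0 hT hS x; apply: le_trans (hT _) _.
by rewrite -mulrA ler_wpM2l.
Qed.

Lemma bddZ H K (T : 'L(H, K)) M t : 0 <= t -> bdd T M -> bdd (t%:C *: T) (t * M).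
Proof.
by move=> t0 hT x; rewrite /= nrmZr // -mulrA ler_wpM2l.
Qed.

Lemma bdd_inf H K (T : 'L(H, K)) M : (forall e, 0 < e -> bdd T (M + e)) -> bdd T M.
Proof.
move=> hT x; have := nrm_ge0 x; rewrite le_eqVlt => /predU1P[x0|x0].
  by rewrite (nrm_eq0 (esym x0)) op0 !nrm0 mulr0.
rewrite -ler_pdivrMr //; apply: le_of_le_add_eps => e e0.
by rewrite ler_pdivrMr //; apply: hT.
Qed.

(* A gliding hump argument: were [T] unbounded, one could choose [y n] of norm
   1 with [nrm (T (y n))] at least [20 ^ n] and signs such that the limit [x] of
   the partial sums of [+/- 10 ^- n *: T (y n) / nrm (T (y n))] makes
   [inner (T (y n)) x = inner (y n) (adj T x)] unbounded in [n]. *)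
Lemma adjop_bounded H K (T : 'L(H, K)) : exists M, 0 < M /\ bdd T M.
Proof.
apply: contrapT => /forallNP hT.
have {}hT n : exists y, nrm y = 1 /\ 20 ^+ n <= nrm (T y).
  have p20 : (0 : R) < 20 ^+ n by rewrite exprn_gt0.
  have /not_andP[//|/existsNP[x]] := hT (20 ^+ n).
  move/negP; rewrite -ltNge => hx.
  have x0 : 0 < nrm x.
    rewrite lt_neqAle nrm_ge0 andbT eq_sym; apply/eqP => x0.
    by move: hx; rewrite (nrm_eq0 x0) op0 !nrm0 mulr0 ltxx.
  exists ((nrm x)^-1%:C *: x); split; first exact: nrm_unit.
  by rewrite opZ nrmZr ?invr_ge0 ?(ltW x0) // ler_pdivlMl // mulrC ltW.
have /choice[y hy] := hT.
have ynorm n : nrm (y n) = 1 by case: (hy n).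
have yT n : 20 ^+ n <= nrm (T (y n)) by case: (hy n).
have Ty0 n : 0 < nrm (T (y n)) by apply: lt_le_trans (yT n); rewrite exprn_gt0.
pose h n := (10^-1 ^+ n / nrm (T (y n)))%:C *: T (y n).
have hnorm n : nrm (h n) = 10^-1 ^+ n.
  rewrite nrmZr ?divfK ?gt_eqF // divr_ge0 ?exprn_ge0 ?invr_ge0 ?ltW //.
pose f n z := nrm (inner (T (y n)) z).
have fh n : f n (h n) = 10^-1 ^+ n * nrm (T (y n)).
  rewrite /f /h innerZr nrmZr ?nrm_inner; last first.
    by rewrite divr_ge0 ?exprn_ge0 ?invr_ge0 ?ltW.
  by rewrite expr2 mulrA divfK ?gt_eqF.
(* Since 2h = (u + h) - (u - h), one of the two signs makes [f m] at least [f m (h m)]. *)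
pose u := fix u n := if n is m.+1 then
  (if f m (h m) <= f m (u m + h m) then u m + h m else u m - h m) else 0.
have uS m : u m.+1 =
  if f m (h m) <= f m (u m + h m) then u m + h m else u m - h m by [].
have uf m : f m (h m) <= f m (u m.+1).
  rewrite uS; case: ifPn => //; rewrite -ltNge => lt1.
  have : f m (h m) + f m (h m) <= f m (u m + h m) + f m (u m - h m).
    rewrite -mulr2n -mulr_natl /f -nrmZr // -innerZr.
    have -> : 2%:R%:C *: h m = (u m + h m) - (u m - h m).
      by rewrite opprB addrC addrA subrK rmorph_nat scaler_nat mulr2n.
    by rewrite innerBr nrmB.
  lra.
have du n : nrm (u n.+1 - u n) <= 1 * 10^-1 ^+ n.
  rewrite mul1r -hnorm uS; case: ifP => _; first by rewrite addrC addKr.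
  by rewrite addrAC subrr add0r nrmN.
have q1 : 0 <= 10^-1 :> R /\ 10^-1 < 1 :> R by lra.
move/andP: q1 => q1.
have [x hx] := geometric_complete q1 du.
(* The later terms cost at most 4/9 of [f n (h n)]: a factor 4 from [nrm_inner_le] and 1/9 from the
   geometric tail. *)
have low n : f n (h n) * 5^-1 <= f n x.
  have : f n (u n.+1) <= f n x + f n (x - u n.+1).
    rewrite /f; have -> : inner (T (y n)) (u n.+1) =
       inner (T (y n)) x - inner (T (y n)) (x - u n.+1).
      by rewrite -innerBr opprB addrC subrK.
    exact: nrmB.
  have : f n (x - u n.+1) <= 4 * nrm (T (y n)) * (1 * 10^-1 ^+ n.+1 / (1 - 10^-1)).
    apply: le_trans (nrm_inner_le _ _) _.
    by rewrite ler_wpM2l ?mulr_ge0 ?nrm_ge0.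
  have := uf n; rewrite fh exprS.
  have := Ty0 n; have : (0 : R) < 10^-1 ^+ n by rewrite exprn_gt0.
  set a := nrm _; set b := _ ^+ n => b0 a0 h1 h2 h3.
  have ab : 0 < b * a by rewrite mulr_gt0.
  have E : 4 * a * (1 * (10^-1 * b) / (1 - 10^-1)) = (4 / 9) * (b * a) by field.
  rewrite E in h2.
  lra.
have up n : f n x <= 4 * nrm ((T^*)%op x).
  rewrite /f adjopE; apply: le_trans (nrm_inner_le _ _) _.
  by rewrite ynorm mulr1.
have low2 n : 2 ^+ n * 5^-1 <= f n x.
  apply: le_trans (low n); rewrite ler_wpM2r //.
  rewrite fh; have -> : (2 : R) = 10^-1 * 20 by field.
  by rewrite exprMn ler_wpM2l // exprn_ge0 //; lra.
have : 5^-1 / (4 * nrm ((T^*)%op x) + 1) <= 0 :> R; last first.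
  rewrite leNgt divr_gt0 //.
  by have := nrm_ge0 ((T^*)%op x); lra.
apply: (@le0_of_le_geometric _ _ 1 2^-1).
  by rewrite invr_ge0 ler0n invf_lt1 ?ltr1n.
move=> n; rewrite mul1r ler_pdivrMr; last by have := nrm_ge0 ((T^*)%op x); lra.
rewrite exprVn ler_pdivlMl ?exprn_gt0 //.
by apply: le_trans (low2 n) _; apply: le_trans (up n) _; rewrite lerDl.
Qed.

End Bounded.

Local Notation "t %:O" := (t%:C *: (1%R : 'L(_)))
  (at level 1, left associativity, format "t %:O") : ring_scope.

(** * The ring of endomorphisms and its involution *)

Section OperatorAlgebra.
Variables (R : realType) (Alg : cstarAlgType R) (H : hilbertModType Alg).
Implicit Types T S U : 'L(H).

Fact opcompA : associative (@opcomp R Alg H H H).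
Proof. by move=> T S U; exact: adjopP. Qed.
Fact opcomp1l : left_id (opid H) (@opcomp R Alg H H H).
Proof. by move=> T; exact: adjopP. Qed.
Fact opcomp1r : right_id (opid H) (@opcomp R Alg H H H).
Proof. by move=> T; exact: adjopP. Qed.
Fact opcompDl : left_distributive (@opcomp R Alg H H H) +%R.
Proof. by move=> T S U; exact: adjopP. Qed.
Fact opcompDr : right_distributive (@opcomp R Alg H H H) +%R.
Proof. by move=> T S U; apply: adjopP => x /=; rewrite opD. Qed.

(** The ring product is [opcomp] by conversion, so both notations can be exchanged. The ring is
    trivial when the module is zero. *)
HB.instance Definition _ := GRing.Zmodule_isPzRing.Build (adjop H H)
  opcompA opcomp1l opcomp1r opcompDl opcompDr.

Lemma opcompZl (k : R[i]) T S : k *: (T * S) = (k *: T) * S.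
Proof. exact: adjopP. Qed.
Lemma opcompZr (k : R[i]) T S : k *: (T * S) = T * (k *: S).
Proof. by apply: adjopP => x /=; rewrite opZ. Qed.

End OperatorAlgebra.

Section Adjoint.
Variables (R : realType) (Alg : cstarAlgType R).

Lemma adjD (H K : hilbertModType Alg) (T S : 'L(H, K)) : adj (T + S) = adj T + adj S.
Proof. exact: adjopP. Qed.

Lemma adjN (H K : hilbertModType Alg) (T : 'L(H, K)) : adj (- T) = - adj T.
Proof. exact: adjopP. Qed.

Lemma adjB (H K : hilbertModType Alg) (T S : 'L(H, K)) : adj (T - S) = adj T - adj S.
Proof. exact: adjopP. Qed.

Lemma adj0 (H K : hilbertModType Alg) : adj (0 : 'L(H, K)) = 0.
Proof. exact: adjopP. Qed.

Lemma adjZr (H K : hilbertModType Alg) (t : R) (T : 'L(H, K)) :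
  adj (t%:C *: T) = t%:C *: adj T.
Proof. by apply: adjopP => x /=; rewrite conj_realC. Qed.

Lemma adjM (H : hilbertModType Alg) (T S : 'L(H)) : adj (T * S) = adj S * adj T.
Proof. exact: adjopP. Qed.

Lemma adj_one (H : hilbertModType Alg) : adj (1 : 'L(H)) = 1.
Proof. exact: adjopP. Qed.

Lemma adj_real (H : hilbertModType Alg) (t : R) : adj (t%:O : 'L(H)) = t%:O.
Proof. by rewrite adjZr adj_one. Qed.

Lemma adjM_scale (H K : hilbertModType Alg) (s : R) (T : 'L(H, K)) :
  (adj (s%:C *: T) * (s%:C *: T))%op = (s * s)%:C *: (adj T * T)%op.
Proof.
apply: adjopP => x; have := opZ (adj T) s%:C (T x); rewrite /= conj_realC => ->.
by rewrite scalerA -rmorphM.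
Qed.

End Adjoint.

(** * Inverses and square roots by self-adjoint iteration *)

Section OperatorOrder.
Variables (R : realType) (Alg : cstarAlgType R) (H : hilbertModType Alg).
Implicit Types (T S a b g h k r y z : 'L(H)) (t e c q M : R).

Lemma realAD t e : (t + e)%:O = t%:O + e%:O :> 'L(H).
Proof. by rewrite rmorphD scalerDl. Qed.

Lemma realAB t e : (t - e)%:O = t%:O - e%:O :> 'L(H).
Proof. by rewrite rmorphB scalerBl. Qed.

Lemma bddB T S M e : bdd T M -> bdd S e -> bdd (T - S) (M + e).
Proof. by move=> hT hS; apply: bddD hT (bddN hS). Qed.

Lemma bdd1 : bdd (1 : 'L(H)) 1.
Proof. by move=> x; rewrite mul1r. Qed.

Lemma bdd_real t : 0 <= t -> bdd (t%:O : 'L(H)) t.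
Proof. by move=> t0; rewrite -[X in bdd _ X]mulr1; apply/bddZ/bdd1. Qed.

Lemma bdd_geometric_eq0 T c q :
  0 <= q < 1 -> (forall n, bdd T (c * q ^+ n)) -> T = 0.
Proof.
move=> hq hT; apply: adjopP => x /=; apply: nrm_eq0; apply/eqP.
rewrite eq_le nrm_ge0 andbT; apply: (@le0_of_le_geometric _ _ (c * nrm x) q) => // n.
by apply: le_trans (hT n x) _; rewrite mulrAC.
Qed.

(** The limit is taken pointwise. Self-adjoint terms make it its own adjoint, which provides the
    adjoint that [AdjOp] requires. *)
Lemma op_geometric_complete (u : nat -> 'L(H)) c q : 0 <= q < 1 ->
  (forall n, adj (u n) = u n) ->
  (forall n, bdd (u n.+1 - u n) (c * q ^+ n)) ->
  exists2 l : 'L(H), adj l = l & forall n, bdd (l - u n) (c / (1 - q) * q ^+ n).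
Proof.
move=> hq uadj hu.
have : forall x, exists l, forall n,
    nrm (l - u n x) <= c * nrm x * q ^+ n / (1 - q).
  move=> x; apply: geometric_complete => // n.
  by apply: le_trans (hu n x) _; rewrite mulrAC.
move=> /choice[l hl].
have ladj : is_adjoint l l.
  move=> x y; apply/eqP; rewrite -subr_eq0; apply/eqP/nrm_eq0/eqP.
  rewrite eq_le nrm_ge0 andbT.
  (* 8 = 4 + 4, one use of [nrm_inner_le] for each error term. *)
  apply: (@le0_of_le_geometric _ _ (8 * c * nrm x * nrm y / (1 - q)) q) => // n.
  have -> : inner (l x) y - inner x (l y) =
      inner (l x - u n x) y - inner x (l y - u n y).
    rewrite innerBl innerBr; have -> : inner (u n x) y = inner x (u n y).
      by rewrite inner_adjr uadj.
    by rewrite opprB addrA subrK.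
  apply: le_trans (nrmB _ _) _.
  have h1 : nrm (inner (l x - u n x) y) <=
      4 * (c * nrm x * q ^+ n / (1 - q)) * nrm y.
    apply: le_trans (nrm_inner_le _ _) _.
    by rewrite ler_wpM2r ?nrm_ge0 // ler_wpM2l.
  have h2 : nrm (inner x (l y - u n y)) <=
      4 * nrm x * (c * nrm y * q ^+ n / (1 - q)).
    apply: le_trans (nrm_inner_le _ _) _.
    by rewrite ler_wpM2l ?mulr_ge0 ?nrm_ge0.
  apply: le_trans (lerD h1 h2) _; rewrite le_eqVlt; apply/orP; left; apply/eqP.
  by ring.
exists (AdjOp ladj); first exact: adjopP.
move=> n x /=; apply: le_trans (hl x n) _.
by rewrite le_eqVlt; apply/orP; left; apply/eqP; ring.
Qed.

(** The iteration u -> 1 + D u produces the partial sums of the Neumann series. Its fixed point is a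
    right inverse of 1 - D, and taking adjoints makes it a left inverse. *)
Lemma neumann D q : 0 <= q < 1 -> adj D = D -> bdd D q ->
  exists r, [/\ adj r = r, r * (1 - D) = 1 & (1 - D) * r = 1].
Proof.
move=> hq Dadj hD.
have /andP[q0 q1] := hq.
pose u := fix u n := if n is m.+1 then 1 + D * u m else 0 : 'L(H).
have uS n : u n.+1 = 1 + D * u n by [].
have uC n : D * u n = u n * D.
  elim: n => [|n ih]; first by rewrite mulr0 mul0r.
  by rewrite uS mulrDr mulrDl mulr1 mul1r -mulrA -ih.
have uadj n : adj (u n) = u n.
  elim: n => [|n ih]; first exact: adj0.
  by rewrite uS adjD adj_one adjM ih Dadj uC.
have du n : bdd (u n.+1 - u n) (1 * q ^+ n).
  elim: n => [|n ih].
    by rewrite uS mulr0 addr0 subr0 expr0 mul1r; apply: bdd1.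
  rewrite !uS opprD addrACA subrr add0r -mulrBr exprS mul1r.
  by apply: bddM => //; rewrite -[X in bdd _ X]mul1r.
have [r radj hr] := op_geometric_complete hq uadj du.
have E : r - (1 + D * r) = 0.
  apply: (@bdd_geometric_eq0 _ ((q + q) / (1 - q)) q) => // n.
  have -> : r - (1 + D * r) = (r - u n.+1) - D * (r - u n).
    by rewrite uS mulrBr opprB [RHS]addrA !opprD !addrA subrK.
  have -> : (q + q) / (1 - q) * q ^+ n =
     1 / (1 - q) * q ^+ n.+1 + q * (1 / (1 - q) * q ^+ n) by rewrite exprS; ring.
  by apply: bddB => //; apply: bddM.
have E1 : (1 - D) * r = 1.
  by move/eqP: E; rewrite subr_eq0 mulrBl mul1r => /eqP{1}->; rewrite addrK.
exists r; split=> //.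
by have := congr1 (@adj _ _ _ _) E1; rewrite adjM radj adjB adj_one Dadj.
Qed.

(** The square of 1 - l is 1 - g exactly when l = (g + l l) / 2. Iterating this equation from 0
    stays in the ball of radius q, with steps shrinking by the factor q, and every iterate commutes
    with whatever commutes with g. *)
Lemma sqrt_one_sub g q : 0 <= q < 1 -> adj g = g -> bdd g q ->
  exists s, [/\ adj s = s, s * s = 1 - g & forall z, z * g = g * z -> z * s = s * z].
Proof.
move=> hq gadj hg.
have /andP[q0 q1] := hq.
pose u := fix u n := if n is m.+1 then 2^-1%:C *: (g + u m * u m) else 0 : 'L(H).
have uS n : u n.+1 = 2^-1%:C *: (g + u n * u n) by [].
have uC z : z * g = g * z -> forall n, z * u n = u n * z.
  move=> zg; elim=> [|n ih]; first by rewrite mulr0 mul0r.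
  by rewrite uS -opcompZr -opcompZl mulrDr mulrDl zg !mulrA ih -!mulrA ih.
have uadj n : adj (u n) = u n.
  elim: n => [|n ih]; first exact: adj0.
  by rewrite uS adjZr adjD gadj adjM ih.
have ub n : bdd (u n) q.
  elim: n => [|n ih]; first by move=> x /=; rewrite nrm0 mulr_ge0 ?nrm_ge0.
  rewrite uS; apply: (@bdd_le _ _ _ _ _ (2^-1 * (q + q * q))); last by nra.
  by apply: bddZ => //; apply: bddD => //; apply: bddM.
have du n : bdd (u n.+1 - u n) (q * q ^+ n).
  elim: n => [|n ih].
    rewrite uS mulr0 addr0 subr0 expr0 mulr1.
    by apply: (@bdd_le _ _ _ _ _ (2^-1 * q)); [exact: bddZ | lra].
  (* Consecutive iterates commute, so the difference of their squares factors. *)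
  have -> : u n.+2 - u n.+1 = 2^-1%:C *: ((u n.+1 + u n) * (u n.+1 - u n)).
    rewrite (uS n.+1) {2}(uS n) -scalerBr; congr (_ *: _).
    have C : u n * u n.+1 = u n.+1 * u n.
      exact: uC (esym (uC g erefl n)) n.+1.
    by rewrite mulrDl !mulrBr C addrA subrK opprD addrACA subrr add0r.
  have -> : q * q ^+ n.+1 = 2^-1 * ((q + q) * (q * q ^+ n)).
    by rewrite exprS; field.
  by apply: bddZ => //; apply: bddM; [lra | exact: bddD |].
have [l ladj hl] := op_geometric_complete hq uadj du.
have [M [M0 hM]] := adjop_bounded l.
have lC z : z * g = g * z -> z * l = l * z.
  move=> zg; apply/eqP; rewrite -subr_eq0; apply/eqP.
  have [N [N0 hN]] := adjop_bounded z.
  apply: (@bdd_geometric_eq0 _ (2 * N * (q / (1 - q))) q) => // n.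
  have -> : z * l - l * z = z * (l - u n) - (l - u n) * z.
    by rewrite mulrBr mulrBl uC // opprB addrA subrK.
  have -> : 2 * N * (q / (1 - q)) * q ^+ n =
     N * (q / (1 - q) * q ^+ n) + (q / (1 - q) * q ^+ n) * N by ring.
  apply: bddB; first by apply: bddM => //; exact: ltW.
  apply: bddM => //; rewrite mulr_ge0 ?exprn_ge0 // divr_ge0 //.
  by rewrite subr_ge0 ltW.
have E : l - 2^-1%:C *: (g + l * l) = 0.
  apply: (@bdd_geometric_eq0 _ ((q + 2^-1 * (q + M)) * (q / (1 - q))) q) => // n.
  have -> : l - 2^-1%:C *: (g + l * l) =
      (l - u n.+1) - 2^-1%:C *: (u n * (l - u n) + (l - u n) * l).
    have -> : u n * (l - u n) + (l - u n) * l = l * l - u n * u n.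
      by rewrite mulrBr mulrBl addrC addrA subrK.
    by rewrite uS -addrA -opprD -scalerDr -addrA (addrC (u n * u n)) subrK.
  have -> : (q + 2^-1 * (q + M)) * (q / (1 - q)) * q ^+ n =
     q / (1 - q) * q ^+ n.+1 + 2^-1 *
       (q * (q / (1 - q) * q ^+ n) + q / (1 - q) * q ^+ n * M).
    by rewrite exprS; ring.
  apply: bddB => //; apply: bddZ => //; apply: bddD; apply: bddM => //.
  by rewrite mulr_ge0 ?exprn_ge0 // divr_ge0 // subr_ge0 ltW.
have E2 : l + l = g + l * l.
  move/eqP: E; rewrite subr_eq0 => /eqP E.
  rewrite -mulr2n -scaler_nat {1}E scalerA -(rmorph_nat (real_complex R)).
  by rewrite -rmorphM /= mulfV ?pnatr_eq0 // scale1r.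
exists (1 - l); split.
- by rewrite adjB adj_one ladj.
- rewrite mulrBl mul1r mulrBr mulr1 opprB.
  have -> : l * l = l + l - g by rewrite E2 addrC addKr.
  by rewrite [l + l - g - l]addrAC addrK addrA subrK.
- by move=> z zg; rewrite mulrBr mulrBl mulr1 mul1r lC.
Qed.

(* [y] and [k] are the real and imaginary parts of the normal operator
   [y + i k], which is [sqrt c] times a unitary. *)
Lemma bdd_of_sqrD y k c : 0 <= c -> adj y = y -> adj k = k -> y * k = k * y ->
  y * y + k * k = c%:O -> bdd y (Num.sqrt c).
Proof.
move=> c0 yadj.
(* Applied to [k] and to [- k]: [y] is the half sum of y + i k and y - i k. *)
suff key l : adj l = l -> y * l = l * y -> y * y + l * l = c%:O ->
    forall x, nrm (y x + 'i *: l x) <= Num.sqrt c * nrm x.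
  move=> kadj yk E x.
  have h1 := key _ kadj yk E x.
  have h2 : nrm (y x + 'i *: (- k) x) <= Num.sqrt c * nrm x.
    by apply: key; rewrite ?adjN ?kadj // ?mulrN ?mulNr ?yk // opprK.
  have : nrm (2%:R%:C *: y x) <= 2 * (Num.sqrt c * nrm x).
    have -> : 2%:R%:C *: y x = (y x + 'i *: k x) + (y x + 'i *: (- k) x).
      by rewrite /= scalerN addrACA subrr addr0 rmorph_nat scaler_nat mulr2n.
    by apply: le_trans (nrmD _ _) _; rewrite mulr_natl mulr2n lerD.
  by rewrite nrmZr // ler_pM2l.
move=> ladj yl E x.
(* The cross terms cancel because [y] and [l] commute. *)
have : nrm (y x + 'i *: l x) ^+ 2 = (Num.sqrt c * nrm x) ^+ 2.
  rewrite -nrm_inner exprMn sqr_sqrtr // -nrm_inner -nrmZr // -innerZr.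
  have -> : c%:C *: x = y (y x) + l (l x).
    by have := congr1 (fun T : 'L(H) => T x) E => /= ->.
  congr nrm; rewrite !innerDl !innerDr !innerZl !innerZr.
  have ya u v : inner (y u) v = inner u (y v) by rewrite inner_adjr yadj.
  have la u v : inner (l u) v = inner u (l v) by rewrite inner_adjr ladj.
  have ly : l (y x) = y (l x) by have := congr1 (fun T : 'L(H) => T x) yl.
  rewrite !ya !la ly scalerA.
  have -> : Num.conj 'i * 'i = 1 :> R[i] by apply/eqP; rewrite eq_complex; simpc.
  have -> : Num.conj 'i = - 'i :> R[i] by apply/eqP; rewrite eq_complex; simpc.
  by rewrite scale1r scaleNr -addrA addNKr.
move=> E2.
by rewrite -(ler_sqr (nrm_ge0 _)) ?E2 // nnegrE mulr_ge0 ?sqrtr_ge0 ?nrm_ge0.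
Qed.

End OperatorOrder.

(** * Positivity *)

Section Positivity.
Variables (R : realType) (Alg : cstarAlgType R) (H : hilbertModType Alg).
Implicit Types (a b g h k r x y z : 'L(H)) (t e c q M : R).

(* In terms of the spectrum: [spos a] says that [a] is positive and invertible,
   [pos a] that [a] is positive. *)
Definition spos a :=
  adj a = a /\ exists t q, [/\ 0 <= q, q < t & bdd (t%:O - a) q].

Definition pos a := forall e, 0 < e -> spos (a + e%:O).

Lemma spos_add_real a e : 0 <= e -> spos a -> spos (a + e%:O).
Proof.
move=> e0 [aadj [t [q [q0 qt hq]]]]; split; first by rewrite adjD aadj adj_real.
exists (t + e), q; split=> //; first lra.
by rewrite realAD opprD addrACA subrr addr0.
Qed.

Lemma spos_le_real a e d : e <= d -> spos (a + e%:O) -> spos (a + d%:O).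
Proof.
move=> ed; have -> : a + d%:O = (a + e%:O) + (d - e)%:O.
  by rewrite realAB -addrA [e%:O + _]addrC subrK.
by apply: spos_add_real; lra.
Qed.

Lemma posP a t : adj a = a -> 0 <= t -> bdd (t%:O - a) t -> pos a.
Proof.
move=> aadj t0 ha e e0; split; first by rewrite adjD aadj adj_real.
exists (t + e), t; split=> //; first lra.
by rewrite realAD opprD addrACA subrr addr0.
Qed.

Lemma sposD a b : spos a -> spos b -> spos (a + b).
Proof.
move=> [aadj [t [q [q0 qt hq]]]] [badj [t' [q' [q0' qt' hq']]]].
split; first by rewrite adjD aadj badj.
exists (t + t'), (q + q'); split; [lra | lra |].
by rewrite realAD opprD addrACA; apply: bddD.
Qed.

Lemma posD a b : pos a -> pos b -> pos (a + b).
Proof.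
move=> ha hb e e0.
have -> : e = e / 2 + e / 2 by field.
by rewrite realAD addrACA; apply: sposD; [apply: ha | apply: hb]; lra.
Qed.

Lemma pos_adj a : pos a -> adj a = a.
Proof.
by move=> /(_ 1 ltr01)[]; rewrite adjD adj_real => /addIr.
Qed.

(** Dividing by t turns a into 1 - D with D of norm at most q / t < 1; [spos_sqrt] uses the same
    normalization. *)
Lemma spos_inv a : spos a -> exists r, [/\ adj r = r, r * a = 1 & a * r = 1].
Proof.
move=> [aadj [t [q [q0 qt hq]]]].
have t0 : 0 < t by apply: le_lt_trans qt.
have [|||r [radj r1 r2]] := @neumann _ _ H (t^-1%:C *: (t%:O - a)) (t^-1 * q).
- by apply/andP; split; [rewrite mulr_ge0 ?invr_ge0 ?(ltW t0) | rewrite ltr_pdivrMl ?mulr1].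
- by rewrite adjZr adjB adj_real aadj.
- by apply: bddZ => //; rewrite invr_ge0 ltW.
have E : 1 - t^-1%:C *: (t%:O - a) = t^-1%:C *: a.
  by rewrite scalerBr scalerA -rmorphM /= mulVf ?gt_eqF // scale1r opprB addrC subrK.
rewrite E in r1 r2.
exists (t^-1%:C *: r); split; first by rewrite adjZr radj.
- by rewrite -opcompZl opcompZr.
- by rewrite -opcompZr opcompZl.
Qed.

Lemma spos_sqrt a : spos a ->
  exists k, [/\ adj k = k, k * k = a & forall z, z * a = a * z -> z * k = k * z].
Proof.
move=> [aadj [t [q [q0 qt hq]]]].
have t0 : 0 < t by apply: le_lt_trans qt.
have [|||s [sadj ss sC]] := @sqrt_one_sub _ _ H (t^-1%:C *: (t%:O - a)) (t^-1 * q).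
- by apply/andP; split; [rewrite mulr_ge0 ?invr_ge0 ?(ltW t0) | rewrite ltr_pdivrMl ?mulr1].
- by rewrite adjZr adjB adj_real aadj.
- by apply: bddZ => //; rewrite invr_ge0 ltW.
exists ((Num.sqrt t)%:C *: s); split; first by rewrite adjZr sadj.
- rewrite -opcompZl -opcompZr scalerA -rmorphM /= -expr2 sqr_sqrtr ?ltW // ss.
  rewrite scalerBr scalerA -rmorphM /= mulfV ?gt_eqF // scale1r.
  by rewrite opprB addrC subrK.
- move=> z za; rewrite -opcompZl -opcompZr; congr (_ *: _); apply: sC.
  by rewrite -opcompZl -opcompZr mulrBr mulrBl za -opcompZr -opcompZl mulr1 mul1r.
Qed.

(** With c = M M + 1, the operator c - h h has a root k commuting with h. As h h + k k = c,
    [bdd_of_sqrD] bounds k by the root of c, so c - h h = k k is bounded by c, as [posP]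
    requires. *)
Lemma pos_sqr h : adj h = h -> pos (h * h).
Proof.
move=> hadj; have [M [M0 hM]] := adjop_bounded h.
have t0 : 0 < M * M + 1 by nra.
have [k [kadj kk kC]] : exists k, [/\ adj k = k, k * k = (M * M + 1)%:O - h * h &
   forall z, z * ((M * M + 1)%:O - h * h) = ((M * M + 1)%:O - h * h) * z ->
   z * k = k * z].
  apply: spos_sqrt; split; first by rewrite adjB adj_real adjM hadj.
  exists (M * M + 1), (M * M); split; [nra | lra |].
  by rewrite opprB addrC subrK; apply: bddM => //; exact: ltW.
have kh : k * h = h * k.
  symmetry; apply: kC; rewrite mulrBr mulrBl mulrA.
  by rewrite -opcompZr -opcompZl mulr1 mul1r.
have kb : bdd k (Num.sqrt (M * M + 1)).
  apply: (@bdd_of_sqrD _ _ _ k h) => //; first exact: ltW.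
  by rewrite kk subrK.
apply: (@posP _ (M * M + 1)); [by rewrite adjM hadj | exact: ltW |].
rewrite -kk -[X in bdd _ X](@sqr_sqrtr _ (M * M + 1)) ?ltW // expr2.
by apply: bddM => //; exact: sqrtr_ge0.
Qed.

(** Only b + e is known to have a root, whence the e. The root commutes with y because b = c - y
    y. *)
Lemma bdd_of_sqr_add_pos y b c : 0 <= c -> adj y = y -> pos b ->
  y * y + b = c%:O -> forall e, 0 < e -> bdd y (Num.sqrt (c + e)).
Proof.
move=> c0 yadj hb E e e0.
have [k [kadj kk kC]] := spos_sqrt (hb e e0).
have bE : b = c%:O - y * y by rewrite -E addrC addKr.
apply: (@bdd_of_sqrD _ _ _ y k) => //; first lra.
  apply: kC; rewrite bE mulrDr mulrDl mulrBr mulrBl mulrA.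
  by rewrite -!opcompZr -!opcompZl mulr1 mul1r.
by rewrite kk addrA E realAD.
Qed.

Lemma bdd_of_pos_add_pos a b c : 0 <= c -> pos a -> pos b -> a + b = c%:O -> bdd a c.
Proof.
move=> c0 ha hb E; apply: bdd_inf => e e0.
(* One e / 4 makes [a] strictly positive, one is lost in [bdd_of_sqr_add_pos], and one is paid when
   subtracting the shift again. *)
have e4 : 0 < e / 4 by lra.
have [k [kadj kk kC]] := spos_sqrt (ha _ e4).
have kb : bdd k (Num.sqrt ((c + e / 4) + e / 4)).
  apply: (@bdd_of_sqr_add_pos k b) => //; first lra.
  by rewrite kk realAD -E addrAC.
have -> : a = k * k - (e / 4)%:O by rewrite kk addrK.
apply: (@bdd_le _ _ _ _ _ ((c + e / 4 + e / 4) + e / 4)); last lra.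
apply: bddB; last by apply: bdd_real; exact: ltW.
rewrite -[X in bdd _ X](@sqr_sqrtr _ (c + e / 4 + e / 4)); last lra.
by rewrite expr2; apply: bddM => //; exact: sqrtr_ge0.
Qed.

End Positivity.

(** * Positivity of adjoint squares *)

Section AdjointSquare.
Variables (R : realType) (Alg : cstarAlgType R) (H : hilbertModType Alg).
Implicit Types (a b g h k r x y z : 'L(H)) (t e c q M l : R).

Lemma half_sub_sqr a : (2^-1%:O - a) * (2^-1%:O - a) = 4^-1%:O - (a - a * a).
Proof.
rewrite mulrBl !mulrBr -!opcompZl -!opcompZr !mul1r mulr1 scalerA -rmorphM /=.
have -> : 2^-1 * 2^-1 = 4^-1 :> R by field.
rewrite -addrA -opprD; congr (_ - _); rewrite addrA; congr (_ - _).
rewrite -scalerDl -rmorphD /=.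
by have -> : 2^-1 + 2^-1 = 1 :> R; [field | rewrite scale1r].
Qed.

(** Here u is twice the real part of z and v is minus twice its imaginary part; both are
    self-adjoint, so [pos_sqr] applies to them. *)
Lemma sqr_add_sqr_imag z : let u := z + adj z in let v := 'i *: (z - adj z) in
  u * u + v * v = (z * adj z + adj z * z) + (z * adj z + adj z * z).
Proof.
move=> u v; rewrite /u /v -opcompZl -opcompZr scalerA -(expr2 'i) sqr_i scaleN1r.
rewrite !(mulrDl, mulrDr, mulrN, mulNr) !opprD !opprK.
rewrite (AC ((2*2)*(2*2)) (((1*5)*(4*8))*((2*3)*(6*7)))) /=.
by rewrite !subrr !add0r.
Qed.

(* Kaplansky's trick. With [w = x r x^*], which is [1] minus the resolvent of
   [x x^*], and [z = x r], the squares of [1/2 - r] and [1/2 - w] are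
   [1/4 - z^* z] and [1/4 - z z^*], while [z^* z + z z^*] is half of a sum of two
   squares. Hence [(1/2 - r)^2] and some positive operator add up to [1]. *)
Lemma resolvent_bound1 x r : adj r = r -> r * (1 + adj x * x) = 1 ->
  (1 + adj x * x) * r = 1 -> bdd r 2.
Proof.
move=> radj r1 r2.
have hr : adj x * x * r = 1 - r by rewrite -r2 mulrDl mul1r addrC addKr.
pose z := x * r; pose w := x * r * adj x.
have zadj : adj z = r * adj x by rewrite adjM radj.
have wadj : adj w = w by rewrite !adjM adjK radj mulrA.
have zz : adj z * z = r - r * r.
  by rewrite zadj -mulrA (mulrA (adj x)) hr mulrBr mulr1.
have zz' : z * adj z = w - w * w.
  have -> : w * w = x * (r * (adj x * x * r)) * adj x by rewrite /w !mulrA.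
  by rewrite hr zadj mulrBr mulr1 mulrBr mulrBl opprB addrC subrK /z !mulrA.
pose y := 2^-1%:O - r; pose y' := 2^-1%:O - w.
pose u := z + adj z; pose v := 'i *: (z - adj z).
have yadj : adj y = y by rewrite adjB adj_real radj.
have y'adj : adj y' = y' by rewrite adjB adj_real wadj.
have uadj : adj u = u by rewrite adjD adjK addrC.
have vadj : adj v = v.
  apply: adjopP => X /=.
  have -> : Num.conj 'i = - 'i :> R[i] by apply/eqP; rewrite eq_complex; simpc.
  by rewrite scaleNr -scalerN opprB.
have hpos : pos (y * y + (y' * y' + y' * y') + (u * u + v * v)).
  by apply: posD; [apply: posD; last apply: posD | apply: posD]; apply: pos_sqr.
(* The four squares of [y] and [y'] give 4/4 - 2p - 2p', and the last two squares give 2p + 2p'. *)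
have E : y * y + (y * y + (y' * y' + y' * y') + (u * u + v * v)) = 1%:O.
  rewrite sqr_add_sqr_imag zz zz' /y /y' !half_sub_sqr.
  set p := r - r * r; set p' := w - w * w.
  rewrite (AC (1*((1*2)*((1*1)*(1*1)))) ((1*2)*(3*4)*((5*7)*(6*8)))) /=.
  rewrite (addrC (p' + p')) addrACA (addrACA (_ - p)) (addrACA (_ - p')) !subrK.
  by rewrite -!realAD; congr (_%:O); field.
(* The choice e = 5/4 makes 1 + e the square of 3/2, and 1/2 + 3/2 = 2. *)
have hy : bdd y (Num.sqrt (1 + 5 / 4)).
  by apply: (bdd_of_sqr_add_pos _ yadj hpos E).
have hs : Num.sqrt (1 + 5 / 4) = 3 / 2 :> R.
  have -> : 1 + 5 / 4 = (3 / 2) ^+ 2 :> R by field.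
  by rewrite sqrtr_sqr ger0_norm.
have -> : r = 2^-1%:O - y by rewrite opprB addrC subrK.
apply: (@bdd_le _ _ _ _ _ (2^-1 + 3 / 2)); last lra.
by apply: bddB; [apply: bdd_real | rewrite -hs].
Qed.

Lemma resolvent_bound x r l : 0 < l -> adj r = r ->
  r * (adj x * x + l%:O) = 1 -> (adj x * x + l%:O) * r = 1 -> bdd r (2 / l).
Proof.
move=> l0 radj r1 r2.
pose s := Num.sqrt l^-1.
have ss : s * s = l^-1 by rewrite -expr2 sqr_sqrtr ?invr_ge0 ?ltW.
have E : 1 + adj (s%:C *: x) * (s%:C *: x) = l^-1%:C *: (adj x * x + l%:O).
  rewrite adjZr -opcompZl -opcompZr scalerA -rmorphM /= ss scalerDr scalerA.
  by rewrite -rmorphM /= mulVf ?gt_eqF // scale1r addrC.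
have hb : bdd (l%:C *: r) 2.
  apply: (@resolvent_bound1 (s%:C *: x)); first by rewrite adjZr radj.
  - by rewrite E -opcompZl -opcompZr scalerA -rmorphM /= mulfV ?gt_eqF // r1 scale1r.
  - by rewrite E -opcompZl -opcompZr scalerA -rmorphM /= mulVf ?gt_eqF // r2 scale1r.
have -> : r = l^-1%:C *: (l%:C *: r).
  by rewrite scalerA -rmorphM /= mulVf ?gt_eqF // scale1r.
by rewrite mulrC; apply: bddZ => //; rewrite invr_ge0 ltW.
Qed.

(** Let g be the given operator and r its inverse. As r is bounded by 2 / l, both g and 3 / l - r
    have roots, which commute. The scaled product h of these roots satisfies h h = (l / 3) g (3 / l
    - r) = g - l / 3, so g - l / 3 is positive; the shift 3/4 l leaves a margin of l / 12 above
    it. *)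
Lemma spos_shrink x l : 0 < l ->
  spos (adj x * x + l%:O) -> spos (adj x * x + (3 / 4 * l)%:O).
Proof.
move=> l0 hg; have [r [radj r1 r2]] := spos_inv hg.
have rb := resolvent_bound l0 radj r1 r2.
have [k [kadj kk kC]] := spos_sqrt hg.
set g := adj x * x + l%:O in hg r1 r2 kk kC.
have kg : k * g = g * k by rewrite -kk mulrA.
have kr : k * r = r * k.
  by rewrite -[LHS]mul1r -r1 -mulrA (mulrA g) -kg -(mulrA k) r2 mulr1.
have l3 : 0 < 3 / l by rewrite divr_gt0.
have [m [madj mm mC]] : exists m, [/\ adj m = m, m * m = (3 / l)%:O - r &
    forall z, z * ((3 / l)%:O - r) = ((3 / l)%:O - r) * z -> z * m = m * z].
  apply: spos_sqrt; split; first by rewrite adjB adj_real radj.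
  exists (3 / l), (2 / l); split; first by rewrite divr_ge0 ?ltW.
  - by rewrite ltr_pM2r ?invr_gt0 // ltr_nat.
  - by rewrite opprB addrC subrK.
have km : k * m = m * k.
  by apply: mC; rewrite mulrBr mulrBl -opcompZr -opcompZl mulr1 mul1r kr.
pose s := Num.sqrt (l / 3).
have ss : s * s = l / 3 by rewrite -expr2 sqr_sqrtr // divr_ge0 ?ltW.
pose h := s%:C *: (k * m).
have hadj : adj h = h by rewrite adjZr adjM kadj madj -km.
have hh : h * h = adj x * x + (2 / 3 * l)%:O.
  rewrite /h -opcompZl -opcompZr scalerA -rmorphM /= ss mulrA -(mulrA k) -km.
  rewrite mulrA kk -mulrA mm mulrBr r2 -opcompZr mulr1 scalerBr scalerA.
  rewrite -rmorphM /=; have -> : l / 3 * (3 / l) = 1 by field; rewrite gt_eqF.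
  by rewrite scale1r /g -addrA -realAB; congr (_ + _%:O); field.
have -> : 3 / 4 * l = 2 / 3 * l + 1 / 12 * l by field.
rewrite realAD addrA -hh; apply: pos_sqr => //.
by rewrite mulr_gt0 // divr_gt0.
Qed.

(** A shift by more than the bound M is clearly strictly positive; [spos_shrink] then reduces it by
    3/4 as often as desired. *)
Theorem pos_adjM x : pos (adj x * x).
Proof.
have hadj : adj (adj x * x) = adj x * x by rewrite adjM adjK.
have [M [M0 hM]] := adjop_bounded (adj x * x).
have hn n : spos (adj x * x + ((3 / 4) ^+ n * (M + 1))%:O).
  elim: n => [|n ih].
    split; first by rewrite adjD hadj adj_real.
    exists (M + 1), M; split; [exact: ltW | lra |].
    by rewrite expr0 mul1r opprD addrA addrAC subrr add0r; apply: bddN.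
  rewrite exprS -mulrA; apply: spos_shrink => //.
  by rewrite mulr_gt0 ?exprn_gt0 //; lra.
move=> e e0.
have [n hne] : exists n, (M + 1) * (3 / 4) ^+ n <= e.
  apply: contrapT => /forallNP hN.
  have : e <= 0; last by rewrite leNgt e0.
  apply: (@le0_of_le_geometric _ _ (M + 1) (3 / 4)).
    by apply/andP; split; lra.
  by move=> n; rewrite leNgt; apply/negP => /ltW; exact: hN.
by apply: spos_le_real (hn n); rewrite mulrC.
Qed.

End AdjointSquare.

(** * Transfer of positivity to the C*-algebra *)

Section AlgebraAsModule.
Variables (R : realType) (Alg : cstarAlgType R).
Implicit Types a b c : Alg.

Let inn a b := cmul (cstar a) b.

Fact alg_innerDr a b c : inn a (b + c) = inn a b + inn a c.
Proof. exact: cmulDr. Qed.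
Fact alg_innerZr (k : R[i]) a b : inn a (k *: b) = k *: inn a b.
Proof. exact: cmulZr. Qed.
Fact alg_inner_ract a b c : inn a (cmul b c) = cmul (inn a b) c.
Proof. exact: cmulA. Qed.
Fact alg_inner_star a b : cstar (inn a b) = inn b a.
Proof. by rewrite /inn cstarM cstarK. Qed.
Fact alg_inner_pos a : cpositive (inn a a).
Proof. by exists a. Qed.
Fact alg_inner_def a : inn a a = 0 -> a = 0.
Proof.
move=> /(congr1 Num.norm); rewrite cstar_norm normr0 => /eqP.
by rewrite sqrf_eq0 normr_eq0 => /eqP.
Qed.
Fact alg_inner_norm a : `|a| ^+ 2 = `|inn a a|.
Proof. by rewrite cstar_norm. Qed.

(** The algebra is a Hilbert module over itself, its norm axiom being the C*-identity. Left
    multiplications thereby become adjointable operators, to which [pos_adjM] applies. *)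
HB.instance Definition _ :=
  @isHilbertModule.Build R Alg (CStarAlgebra.sort Alg) cmul inn
    cmulA cmulDl cmulDr cmulZl cmulZr alg_innerDr alg_innerZr alg_inner_ract
    alg_inner_star alg_inner_pos alg_inner_def alg_inner_norm.

Fact lmul_subproof a : is_adjoint (cmul a : Alg -> Alg) (cmul (cstar a)).
Proof. by move=> b c; rewrite /inner /= /inn cstarM cmulA. Qed.
Definition lmul a : 'L(Alg) := AdjOp (lmul_subproof a).

(* Positivity is read off multiplication operators, because [Alg] has no unit. *)
Definition apos a := pos (lmul a).

Lemma lmulD a b : lmul (a + b) = lmul a + lmul b.
Proof. by apply: adjopP => x; exact: cmulDl. Qed.

Lemma aposD a b : apos a -> apos b -> apos (a + b).
Proof. by rewrite /apos lmulD; exact: posD. Qed.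

Lemma cpositive_apos a : cpositive a -> apos a.
Proof.
move=> [b ->]; rewrite /apos.
have -> : lmul (cmul (cstar b) b) = adj (lmul b) * lmul b.
  by apply: adjopP => x /=; rewrite cmulA.
exact: pos_adjM.
Qed.

Lemma nrm_cmul a b : nrm (cmul a b) <= nrm a * nrm b.
Proof. by rewrite -lecR rmorphM /= -!nrmC cmul_norm. Qed.

Lemma nrm_cstar a : nrm (cmul (cstar a) a) = nrm a ^+ 2.
Proof. by apply: complexI; rewrite rmorphXn /= -!nrmC cstar_norm. Qed.

Lemma nrm_le_cstar a : nrm a <= nrm (cstar a).
Proof.
have := nrm_cmul (cstar a) a; rewrite nrm_cstar.
have := nrm_ge0 a; have := nrm_ge0 (cstar a); nra.
Qed.

(** Left multiplication by a, plus the positive operator [lmul b] + (c - [lmul (a + b)]), equals c,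
    so [bdd_of_pos_add_pos] bounds it by c. *)
Lemma nrm_le_aposD a b : apos a -> apos b -> nrm a <= nrm (a + b).
Proof.
move=> ha hb; set c := nrm (a + b).
have c0 : 0 <= c by exact: nrm_ge0.
have hab : bdd (lmul (a + b)) c by move=> x; exact: nrm_cmul.
have hc : pos (c%:C *: (1 : 'L(Alg)) - lmul (a + b)).
  apply: (@posP _ _ _ _ c) => //; last by rewrite opprB addrC subrK.
  by rewrite adjB adj_real (pos_adj (aposD ha hb)).
have hA : bdd (lmul a) c.
  apply: (bdd_of_pos_add_pos c0 ha (posD hb hc)).
  by rewrite addrA -lmulD addrC subrK.
(* Evaluating at [cstar a] and using the C*-identity gives |a^*|^2 <= c |a^*|. *)
apply: le_trans (nrm_le_cstar a) _.
have := hA (cstar a); rewrite /= -{1}(cstarK a) nrm_cstar.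
have := nrm_ge0 (cstar a); nra.
Qed.

Lemma nrm_le_aposDr a b : apos a -> apos b -> nrm b <= nrm (a + b).
Proof. by rewrite addrC => ha hb; exact: nrm_le_aposD. Qed.

End AlgebraAsModule.

(** * Invertibility of coercive operators *)

Section Coercive.
Variables (R : realType) (Alg : cstarAlgType R).
Implicit Types (H K E : hilbertModType Alg).

Lemma apos_inner H (x : H) : apos (inner x x).
Proof. by apply: cpositive_apos; exact: inner_pos. Qed.

Lemma adj_inv H (G Y : 'L(H)) : adj G = G -> Y * G = 1 -> G * Y = 1 -> adj Y = Y.
Proof.
move=> Gadj YG GY.
have := congr1 (@adj _ _ _ _) GY; rewrite adjM adj_one Gadj => h.
by rewrite -[LHS]mulr1 -GY mulrA h mul1r.
Qed.

(** Continuity method: G + l is invertible for large l, and the lower bound [low], uniform in l >=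
    0, allows descending to l = 0 in steps of fixed size d. *)
Lemma coercive_inv H (G : 'L(H)) C : 0 < C -> adj G = G ->
  (forall x, apos (inner x (G x))) ->
  (forall x, nrm x ^+ 2 <= C * nrm (inner x (G x))) ->
  exists Y, [/\ adj Y = Y, Y * G = 1 & G * Y = 1].
Proof.
move=> C0 Gadj Gpos Gco.
pose G_ l := G + l%:O.
have G_adj l : adj (G_ l) = G_ l by rewrite adjD Gadj adj_real.
have low l x : 0 <= l -> nrm x <= 4 * C * nrm (G_ l x).
  move=> l0.
  have h1 : nrm x ^+ 2 <= C * (4 * nrm x * nrm (G_ l x)).
    apply: le_trans (Gco x) _; rewrite ler_pM2l //.
    apply: le_trans (nrm_inner_le _ _); rewrite /G_ /= innerDr.
    apply: nrm_le_aposD; first exact: Gpos.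
    have -> : inner x (l%:C *: x) =
        inner ((Num.sqrt l)%:C *: x) ((Num.sqrt l)%:C *: x).
      rewrite innerZl !innerZr conj_realC scalerA -rmorphM /= -expr2.
      by rewrite sqr_sqrtr.
    exact: apos_inner.
  have := nrm_ge0 x; rewrite le_eqVlt => /predU1P[<-|x0].
    by rewrite !mulr_ge0 ?nrm_ge0 // ltW.
  rewrite -(ler_pM2l x0) -expr2; apply: le_trans h1 _.
  by rewrite le_eqVlt; apply/orP; left; apply/eqP; ring.
pose inv l := exists Y, Y * G_ l = 1 /\ G_ l * Y = 1.
(* Inverses are bounded by 4 C, so d times an inverse is bounded by 1/2 and [neumann] applies. *)
pose d := (8 * C)^-1.
have d0 : 0 < d by rewrite invr_gt0 mulr_gt0.
have step l : 0 <= l -> inv (l + d) -> inv l.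
  move=> l0 [Y [YG GY]].
  have Yadj := adj_inv (G_adj _) YG GY.
  have Yb : bdd Y (4 * C).
    move=> x; apply: le_trans (low (l + d) (Y x) _) _.
      by rewrite addr_ge0 // ltW.
    by have /= -> := congr1 (fun T : 'L(H) => T x) GY.
  have [|||r [radj r1 r2]] := @neumann _ _ H (d%:C *: Y) 2^-1.
  - by apply/andP; split; lra.
  - by rewrite adjZr Yadj.
  - have -> : 2^-1 = d * (4 * C) by rewrite /d; field; rewrite gt_eqF.
    by apply: bddZ => //; exact: ltW.
  have El : G_ l = G_ (l + d) * (1 - d%:C *: Y).
    by rewrite mulrBr mulr1 -opcompZr GY /G_ realAD addrA addrK.
  have Er : G_ l = (1 - d%:C *: Y) * G_ (l + d).
    by rewrite mulrBl mul1r -opcompZl YG /G_ realAD addrA addrK.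
  have left : (r * Y) * G_ l = 1 by rewrite El mulrA -(mulrA r) YG mulr1.
  have right : G_ l * (Y * r) = 1 by rewrite Er mulrA -(mulrA _ _ Y) GY mulr1.
  exists (r * Y); split=> //.
  have -> : r * Y = Y * r.
    by rewrite -[LHS]mulr1 -right mulrA left mul1r.
  exact: right.
have descend n : inv (n%:R * d) -> inv 0.
  elim: n => [|n ih]; first by rewrite mul0r.
  rewrite -natr1 mulrDl mul1r => h; apply: ih; apply: step h.
  by rewrite mulr_ge0 // ltW.
have [M [M0 hM]] := adjop_bounded G.
have [n hn] : exists n : nat, M < n%:R * d.
  exists (Num.truncn (M / d)).+1; rewrite -ltr_pdivrMr //.
  by have := truncnS_gt (M / d).
have [Y [Yadj YG GY]] : exists r, [/\ adj r = r, r * G_ (n%:R * d) = 1 & G_ (n%:R * d) * r = 1].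
  apply: spos_inv; split; first exact: G_adj.
  exists (n%:R * d), M; split; [exact: ltW | exact: hn |].
  by rewrite opprD addrCA subrr addr0; apply: bddN.
have [Z []] := descend n (ex_intro _ Y (conj YG GY)).
rewrite /G_ rmorph0 scale0r addr0 => ZG GZ.
by exists Z; split=> //; exact: adj_inv ZG GZ.
Qed.

End Coercive.

(** * Moore-Penrose inverses *)

Section MoorePenrose.
Variables (R : realType) (Alg : cstarAlgType R).
Implicit Types (H K E : hilbertModType Alg).

Lemma adj_comp H K E (T : 'L(K, E)) (S : 'L(H, K)) :
  adj (T * S)%op = (adj S * adj T)%op.
Proof. exact: adjopP. Qed.

Lemma comp_assoc H K E F (T : adjop E F) (S : 'L(K, E)) (U : 'L(H, K)) :
  (T * (S * U) = T * S * U)%op.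
Proof. exact: adjopP. Qed.

(** T X and T Y are self-adjoint and each absorbs the other, so they agree; likewise X T and Y T. *)
Lemma mpinv_unique H K (T : 'L(H, K)) X Y : is_mpinv T X -> is_mpinv T Y -> X = Y.
Proof.
move=> [TXT XTX TX XT] [TYT YTY TY YT].
have eTX : (T * X = T * Y)%op.
  have e1 : (T * X * (T * Y) = T * Y)%op by rewrite comp_assoc TXT.
  have e2 : (T * Y * (T * X) = T * X)%op by rewrite comp_assoc TYT.
  by rewrite -TX -[in LHS]e2 adj_comp TX TY e1.
have eXT : (X * T = Y * T)%op.
  have e1 : (X * T * (Y * T) = X * T)%op by rewrite -comp_assoc (comp_assoc T) TYT.
  have e2 : (Y * T * (X * T) = Y * T)%op by rewrite -comp_assoc (comp_assoc T) TXT.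
  by rewrite -XT -[in LHS]e1 adj_comp XT YT e2.
by rewrite -XTX -comp_assoc eTX comp_assoc eXT YTY.
Qed.

Lemma mpinv_eq H K (T : 'L(H, K)) X : is_mpinv T X -> mpinv T = X.
Proof. by move=> hX; apply: (mpinv_unique _ hX); apply: (xgetPex 0); exists X. Qed.

Lemma mpinvP H K (T : 'L(H, K)) : mp_invertible T -> is_mpinv T (mpinv T).
Proof. by move=> [X hX]; rewrite (mpinv_eq hX). Qed.

Lemma is_mpinv_adj H K (T : 'L(H, K)) X : is_mpinv T X -> is_mpinv (adj T) (adj X).
Proof.
move=> [TXT XTX TX XT]; split.
- by rewrite -!adj_comp comp_assoc TXT.
- by rewrite -!adj_comp comp_assoc XTX.
- by rewrite -!adj_comp adjK XT.
- by rewrite -!adj_comp adjK TX.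
Qed.

Lemma opinv_eq H (T X : 'L(H)) : is_opinv T X -> opinv T = X.
Proof.
move=> hX; have [YT TY] : is_opinv T (opinv T) by apply: (xgetPex 0); exists X.
case: hX => XT TX; rewrite -[LHS](@opcomp1r _ _ H) -TX.
by rewrite opcompA YT (@opcomp1l _ _ H).
Qed.

(** G + (1 - N) is coercive, since its form is the sum of two positive terms controlling N x and x -
    N x. If Y is its inverse, N Y is the M-P inverse of G. *)
Lemma mpinv_coercive H (G N : 'L(H)) C : 0 < C -> adj G = G -> adj N = N ->
  G * N = G -> (forall x, apos (inner x (G x))) ->
  (forall x, nrm (N x) ^+ 2 <= C * nrm (inner x (G x))) ->
  exists X, [/\ is_mpinv G X, (X * G)%op = N & (G * X)%op = N].
Proof.
move=> C0 Gadj Nadj GN Gpos Gco.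
have vGN x : G (N x) = G x := congr1 (fun S : 'L(H) => S x) GN.
(* Idempotence follows from coercivity at N x - x, which G kills. *)
have vNN x : N (N x) = N x.
  apply/eqP; rewrite -subr_eq0 -opB; apply/eqP/nrm_eq0/eqP.
  have := Gco (N x - x); rewrite (opB G) vGN subrr inner0r nrm0 mulr0 => h.
  by rewrite -sqrf_eq0 eq_le h sqr_ge0.
have NN : N * N = N by exact: adjopP.
have NG : N * G = G by have := congr1 (@adj _ _ _ _) GN; rewrite adjM Gadj Nadj.
have vN x y : inner (N x) y = inner x (N y) by rewrite inner_adjr Nadj.
pose G' := G + (1 - N).
have G'E x : inner x (G' x) = inner x (G x) + inner (x - N x) (x - N x).
  rewrite /G' /= innerDr; congr (_ + _).
  by rewrite innerBl vN opB vNN subrr inner0r subr0.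
(* From |x|^2 <= 2 |N x|^2 + 2 |x - N x|^2. *)
have [||||Y [Yadj YG GY]] := @coercive_inv _ _ _ G' (2 * C + 2).
- lra.
- by rewrite adjD adjB adj_one Gadj Nadj.
- by move=> x; rewrite G'E; apply: aposD => //; exact: apos_inner.
- move=> x; have h1 : nrm (inner x (G x)) <= nrm (inner x (G' x)).
    by rewrite G'E; apply: nrm_le_aposD => //; exact: apos_inner.
  have h2 : nrm (x - N x) ^+ 2 <= nrm (inner x (G' x)).
    by rewrite G'E -nrm_inner; apply: nrm_le_aposDr => //; exact: apos_inner.
  have h3 : nrm x <= nrm (N x) + nrm (x - N x).
    by rewrite -{1}(subrK (N x) x) addrC nrmD.
  have h4 := Gco x.
  have := nrm_ge0 x; have := nrm_ge0 (N x); have := nrm_ge0 (x - N x).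
  move: h1 h2 h3 h4; set n := nrm x; set p := nrm (N x); set d := nrm (x - N x).
  set u := nrm _; set v := nrm _ => h1 h2 h3 h4 d0 p0 n0.
  have h5 : n ^+ 2 <= (p + d) ^+ 2 by rewrite ler_sqr // nnegrE; lra.
  have h6 : 0 <= (p - d) ^+ 2 by exact: sqr_ge0.
  have h7 : C * u <= C * v by rewrite ler_pM2l.
  nra.
have NG' : N * G' = G by rewrite mulrDr NG mulrBr mulr1 NN subrr addr0.
have G'N : G' * N = G by rewrite mulrDl GN mulrBl mul1r NN subrr addr0.
have NY : N * Y = Y * N.
  by rewrite -[LHS]mul1r -YG -mulrA (mulrA G') G'N -NG' -mulrA GY mulr1.
have XG : N * Y * G = N by rewrite -G'N -mulrA (mulrA Y) YG mul1r NN.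
have GX : G * (N * Y) = N by rewrite mulrA GN -NG' -mulrA GY mulr1.
exists (N * Y); split=> //; split.
- by rewrite -[LHS]/(G * (N * Y) * G) GX.
- by rewrite -[LHS]/(N * Y * G * (N * Y)) XG mulrA NN.
- by rewrite -[(_ * _)%op]/(G * (N * Y)) GX.
- by rewrite -[(_ * _)%op]/(N * Y * G) XG.
Qed.

Lemma mpinv_sum_adjM H K E (T : 'L(H, K)) (S : 'L(H, E)) (N : 'L(H)) C :
  0 < C -> adj N = N -> (forall x, T (N x) = T x) -> (forall x, S (N x) = S x) ->
  (forall x, nrm (N x) <= C * (nrm (T x) + nrm (S x))) ->
  exists X, [/\ is_mpinv (adj T * T + adj S * S)%op X,
    (X * (adj T * T + adj S * S))%op = N & ((adj T * T + adj S * S) * X)%op = N].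
Proof.
move=> C0 Nadj TN SN hN.
have E1 x : inner x ((adj T * T + adj S * S)%op x) =
    inner (T x) (T x) + inner (S x) (S x).
  by rewrite /= innerDr -!adjopE.
(* The norm of the form dominates both |T x|^2 and |S x|^2, so (|T x| + |S x|)^2 is at most 4 times
   it. *)
apply: (@mpinv_coercive _ _ _ (4 * C ^+ 2)) => //.
- by rewrite mulr_gt0 // exprn_gt0.
- by rewrite adjD !adj_comp !adjK.
- by apply: adjopP => x /=; rewrite TN SN.
- by move=> x; rewrite E1; apply: aposD; exact: apos_inner.
move=> x; rewrite E1.
have h1 : nrm (T x) ^+ 2 <= nrm (inner (T x) (T x) + inner (S x) (S x)).
  by rewrite -nrm_inner; apply: nrm_le_aposD; exact: apos_inner.
have h2 : nrm (S x) ^+ 2 <= nrm (inner (T x) (T x) + inner (S x) (S x)).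
  by rewrite -nrm_inner; apply: nrm_le_aposDr; exact: apos_inner.
have := hN x; have := nrm_ge0 (N x); have := nrm_ge0 (T x); have := nrm_ge0 (S x).
move: h1 h2; set a := nrm (T x); set b := nrm (S x); set v := nrm (_ + _).
set n := nrm _ => h1 h2 b0 a0 n0 hn.
have h3 : n ^+ 2 <= (C * (a + b)) ^+ 2.
  by rewrite ler_sqr // nnegrE ?mulr_ge0 ?addr_ge0 // ltW.
apply: le_trans h3 _; have -> : 4 * C ^+ 2 * v = C ^+ 2 * (4 * v) by ring.
rewrite exprMn ler_pM2l ?exprn_gt0 //.
have := sqr_ge0 (a - b); nra.
Qed.

(** This is the case S = 0; the M-P inverse of T is that of T^* T followed on the right by T^*. *)
Lemma mpinv_lower_bound H K (T : 'L(H, K)) (N : 'L(H)) C :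
  0 < C -> adj N = N -> (forall x, T (N x) = T x) ->
  (forall x, nrm (N x) <= C * nrm (T x)) ->
  (exists X, [/\ is_mpinv (adj T * T)%op X, (X * (adj T * T))%op = N &
                ((adj T * T) * X)%op = N]) /\ mp_invertible T.
Proof.
move=> C0 Nadj TN hN.
have [//|x|X [hX XG GX]] := @mpinv_sum_adjM H K K T 0 N C C0 Nadj TN.
  by rewrite /= nrm0 addr0.
have E0 : (adj T * T + adj (0 : 'L(H, K)) * 0)%op = (adj T * T)%op.
  by apply: adjopP => x /=; rewrite addr0.
rewrite E0 in hX XG GX.
split; first by exists X.
have Xadj : adj X = X.
  have := is_mpinv_adj hX; rewrite adj_comp adjK => hX'.
  exact: mpinv_unique hX' hX.
have vTN : (T * N)%op = T by exact: adjopP.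
case: hX => _ XGX _ _.
exists (X * adj T)%op; split.
- by rewrite -!comp_assoc XG.
- by apply: adjopP => y; exact: (congr1 (fun S : 'L(H) => S (adj T y)) XGX).
- by rewrite !adj_comp adjK Xadj comp_assoc.
- by rewrite -comp_assoc XG.
Qed.

(** S comes from the definition of positivity. With Z the inverse of W, Z S^* is a bounded left
    inverse of S. *)
Lemma posdef_sqrt H (W : 'L(H)) : op_posdef W -> exists (S : 'L(H)) (c : R),
  [/\ 0 < c, W = (adj S * S)%op & forall x, nrm x <= c * nrm (S x)].
Proof.
move=> [[S WE] [Z [ZW _]]].
have [c [c0 hc]] := adjop_bounded (Z * adj S)%op.
exists S, c; split=> // x; rewrite -[X in nrm X <= _]/(opid H x) -ZW WE.
exact: hc.
Qed.

Lemma opnorm_ge0 H K (T : 'L(H, K)) : (0 <= opnorm T)%E.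
Proof.
by apply: ereal_sup_ubound; exists 0 => /=; rewrite ?op0 normr0.
Qed.

Lemma opnorm_le H K (T : 'L(H, K)) M : 0 <= M -> bdd T M -> (opnorm T <= M%:E)%E.
Proof.
move=> M0 hT; apply: ge_ereal_sup => _ [x /= x1 <-]; rewrite lee_fin.
apply: le_trans (hT x) _; rewrite -[leRHS]mulr1 ler_wpM2l //.
by rewrite -lecR -nrmC.
Qed.

End MoorePenrose.

Section WeightedPair.
Variables (R : realType) (Alg : cstarAlgType R) (H K E : hilbertModType Alg).

(* [N] is the orthogonal projection onto [R(A^* ) + R(B^* )]. *)
Lemma range_sum_projection (A : 'L(H, K)) (B : 'L(H, E)) :
  mp_invertible (adj A * A + adj B * B)%op ->
  exists (N : 'L(H)) (c : R), [/\ 0 < c, adj N = N,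
    forall x, A (N x) = A x, forall x, B (N x) = B x &
    forall x, nrm (N x) <= c * (nrm (A x) + nrm (B x))].
Proof.
move=> [X [SXS _ _ XS]]; set S := (_ + _)%op in SXS XS.
exists (X * S)%op.
have vS x : S (X (S x)) = S x := congr1 (fun T : 'L(H) => T x) SXS.
(* Two positive elements with sum 0 vanish, by [nrm_le_aposD] and [nrm_le_aposDr]. *)
have ker x : S x = 0 -> A x = 0 /\ B x = 0.
  move=> Sx.
  have E0 : inner (A x) (A x) + inner (B x) (B x) = 0.
    by rewrite !adjopE -innerDr -[X in inner x X]/(S x) Sx inner0r.
  split; apply: nrm_eq0; apply/eqP; rewrite -sqrf_eq0 eq_le sqr_ge0 andbT -nrm_inner.
    rewrite -(@nrm0 _ Alg) -E0; apply: nrm_le_aposD; exact: apos_inner.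
  rewrite -(@nrm0 _ Alg) -E0; apply: nrm_le_aposDr; exact: apos_inner.
have S0 x : S (X (S x) - x) = 0 by rewrite opB vS subrr.
have [M [M0 hM]] := adjop_bounded (X * adj A)%op.
have [M' [M'0 hM']] := adjop_bounded (X * adj B)%op.
exists (M + M'); split=> //; first exact: addr_gt0.
- by move=> x; apply/eqP; rewrite -subr_eq0 -opB; apply/eqP; case: (ker _ (S0 x)).
- by move=> x; apply/eqP; rewrite -subr_eq0 -opB; apply/eqP; case: (ker _ (S0 x)).
move=> x; rewrite /= opD; apply: le_trans (nrmD _ _) _.
have := hM (A x); have := hM' (B x); rewrite /=.
have := nrm_ge0 (A x); have := nrm_ge0 (B x).
set a := nrm (A x); set b := nrm (B x); move=> b0 a0 h1 h2.
apply: le_trans (lerD h2 h1) _.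
have : 0 <= M' * a by rewrite mulr_ge0 // ltW.
have : 0 <= M * b by rewrite mulr_ge0 // ltW.
lra.
Qed.

End WeightedPair.

(** * Separated pairs and weights *)

Section SeparatedPair.
Variables (R : realType) (Alg : cstarAlgType R) (H K E : hilbertModType Alg).

Lemma mp_projection (A : 'L(H, K)) : mp_invertible A ->
  let P := (mpinv A * A)%op in
  [/\ adj P = P, forall x, A (P x) = A x, forall x, P (P x) = P x,
      forall y, P (adj A y) = adj A y & forall x, exists y, P x = adj A y].
Proof.
move=> /mpinvP[AXA XAX AX XA] P.
have vA x : A (P x) = A x := congr1 (fun T : 'L(H, K) => T x) AXA.
split=> // [x|y|x].
- by rewrite /P /= -/(P x) vA.
- have := congr1 (fun T : 'L(H, K) => adj T y) AXA.
  by rewrite -comp_assoc adj_comp XA.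
- by exists (adj (mpinv A) x); rewrite /P -XA.
Qed.

(** 2 - P - Q is the sum of the squares of 1 - P and 1 - Q. Writing x = (x - Q x) + Q x shows that
    this sum is coercive, and an M-P inverse with support 1 is an inverse. *)
Lemma is_opinv_two_sub_projections (P Q : 'L(H)) c : 0 < c ->
  adj P = P -> adj Q = Q -> (forall x, P (P x) = P x) -> (forall x, Q (Q x) = Q x) ->
  (forall x, nrm (Q x) <= c * nrm (Q x - P (Q x))) ->
  op_invertible (2%:R *: opid H - P - Q).
Proof.
move=> c0 Padj Qadj PP QQ hQ.
have [M [M0 hM]] := adjop_bounded (1 - P).
have [|||||X [_ XG GX]] := @mpinv_sum_adjM _ _ H H H (1 - P) (1 - Q) 1 (1 + c * (M + 1)).
- by rewrite ltr_pwDl // mulr_ge0 ?addr_ge0 // ltW.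
- exact: adj_one.
- by [].
- by [].
- move=> x; rewrite /=.
  have h1 : nrm x <= nrm (x - Q x) + nrm (Q x) by rewrite -{1}(subrK (Q x) x) nrmD.
  have h2 := hQ x.
  have h3 : nrm (Q x - P (Q x)) <= nrm (x - P x) + M * nrm (x - Q x).
    have -> : Q x - P (Q x) = (x - P x) - (1 - P) (x - Q x).
      by rewrite /= (opB P) !opprB addrA (addrA (x - P x)) subrK addrC addrA subrK.
    by apply: le_trans (nrmB _ _) _; rewrite lerD2l.
  have := nrm_ge0 (x - P x); have := nrm_ge0 (x - Q x).
  move: h1 h2 h3; set n := nrm x; set q := nrm (Q x); set p := nrm (x - P x).
  set d := nrm (x - Q x); set v := nrm _ => h1 h2 h3 d0 p0.
  have h4 : c * v <= c * (p + M * d) by rewrite ler_pM2l.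
  have : 0 <= c * p * M by rewrite !mulr_ge0 // ltW.
  have : 0 <= c * d by rewrite mulr_ge0 // ltW.
  lra.
have GE : (adj (1 - P) * (1 - P) + adj (1 - Q) * (1 - Q))%op = 2%:R *: opid H - P - Q.
  apply: adjopP => x; rewrite adjB adj_one Padj adjB adj_one Qadj /=.
  rewrite (opB P) (opB Q) PP QQ !subrr !subr0 addrACA addrA.
  by rewrite scaler_nat mulr2n.
by exists X; rewrite -GE.
Qed.

(** As B1 factors through P, the part N - P is controlled by C = B2 (1 - P) alone, so C is M-P
    invertible. Trivial intersection then transfers its range projection F to B2. *)
Lemma separated_pair_bounds (A : 'L(H, K)) (B1 B2 : 'L(H, E)) (N : 'L(H)) (c : R) :
  let P := (mpinv A * A)%op in
  mp_invertible A -> range (adj B1) `<=` range (adj A) ->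
  range (adj A) `&` range (adj B2) = [set 0] ->
  0 < c -> adj N = N -> (forall x, A (N x) = A x) ->
  (forall x, (B1 + B2) (N x) = (B1 + B2) x) ->
  (forall x, nrm (N x) <= c * (nrm (A x) + nrm ((B1 + B2) x))) ->
  [/\ forall x, B1 (P x) = B1 x, forall x, B2 (N x) = B2 x,
      exists2 c', 0 < c' & forall x, nrm (N x) <= c' * (nrm (A x) + nrm (B2 x)),
      mp_invertible B2 &
      exists2 c', 0 < c' & forall y, nrm (adj B2 y) <= c' * nrm (adj B2 y - P (adj B2 y))].
Proof.
move=> P A_mp B1_range sep c0 Nadj AN BN hN.
have [Padj AP PP PA Pran] := mp_projection A_mp; rewrite -/P in Padj AP PP PA Pran.
have [M [M0 hM]] : exists M, 0 < M /\ forall x, nrm (P x) <= M * nrm (A x).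
  by have [M [M0 hM]] := adjop_bounded (mpinv A); exists M; split=> // x; exact: hM.
have PN x : P (N x) = P x by rewrite /P /= AN.
clearbody P.
have PB1 y : P (adj B1 y) = adj B1 y.
  by have [z _ <-] := B1_range _ (imageT (adj B1) y); exact: PA.
have B1P x : B1 (P x) = B1 x.
  by apply: inner_ext => y; rewrite !inner_adjr Padj PB1.
have NP x : N (P x) = P x.
  by apply: inner_ext => y; rewrite (inner_adjr N) Nadj !(inner_adjr P) Padj PN.
have B1N x : B1 (N x) = B1 x by rewrite -B1P PN B1P.
have B2N x : B2 (N x) = B2 x by have := BN x; rewrite /= B1N => /addrI.
have A0 x : A (x - P x) = 0 by rewrite opB AP subrr.
have NB2 x : nrm (N x - P x) <= c * nrm (B2 (x - P x)).
  have -> : N x - P x = N (x - P x) by rewrite opB NP.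
  by apply: le_trans (hN _) _; rewrite A0 nrm0 add0r /= (opB B1) B1P subrr add0r.
have [M2 [M20 hM2]] := adjop_bounded B2.
have N_le x : nrm (N x) <= (c * (1 + M2 * M) + M) * (nrm (A x) + nrm (B2 x)).
  have -> : N x = (N x - P x) + P x by rewrite subrK.
  apply: le_trans (nrmD _ _) _.
  have h1 := hM x.
  have h2 := NB2 x; rewrite opB in h2.
  have h3 := nrmB (B2 x) (B2 (P x)).
  have h4 := hM2 (P x).
  have := nrm_ge0 (A x); have := nrm_ge0 (B2 x).
  move: h1 h2 h3 h4; set a := nrm (A x); set b := nrm (B2 x); set p := nrm (P x).
  move=> h1 h2 h3 h4 b0 a0.
  have h5 : M2 * p <= M2 * (M * a) by rewrite ler_pM2l.
  have h6 : c * nrm (B2 x - B2 (P x)) <= c * (b + M2 * (M * a)).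
    by rewrite ler_pM2l //; lra.
  have : 0 <= c * (M2 * M) * b by rewrite !mulr_ge0 // ltW.
  have : 0 <= c * a by rewrite mulr_ge0 // ltW.
  have : 0 <= M * b by rewrite mulr_ge0 // ltW.
  lra.
pose C := (B2 * (1 - P))%op.
have CE x : C x = B2 (x - P x) by [].
have Q0adj : adj (N - P) = N - P by rewrite adjB Nadj Padj.
have CQ0 x : C ((N - P) x) = C x.
  by rewrite !CE /= (opB P) PN PP subrr subr0 !opB B2N.
have [|_ [Cd [CCdC _ CCdadj _]]] := @mpinv_lower_bound _ _ _ _ C (N - P) c c0 Q0adj CQ0.
  by move=> x; rewrite CE; exact: NB2.
pose F := (C * Cd)%op.
have CadjE y : adj C y = adj B2 y - P (adj B2 y).
  by rewrite /C adj_comp adjB adj_one Padj.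
have CF y : adj C (F y) = adj C y.
  by have := congr1 (fun T : 'L(H, E) => adj T y) CCdC; rewrite adj_comp CCdadj.
(* [adj C] kills F y - y, so [adj B2] sends F y - y to a vector fixed by P, which lies in both
   ranges. *)
have B2F y : adj B2 (F y) = adj B2 y.
  apply/eqP; rewrite -subr_eq0 -opB; apply/eqP.
  set w := adj B2 _.
  have : adj C (F y - y) = 0 by rewrite opB CF subrr.
  rewrite CadjE -/w => /eqP; rewrite subr_eq0 => /eqP wP.
  have : (range (adj A) `&` range (adj B2)) w.
    split; last by exists (F y - y).
    by rewrite wP; have [z ->] := Pran w; exists z.
  by rewrite sep.
have [M3 [M30 hM3]] := adjop_bounded (adj Cd).
(* F is self-adjoint, hence also [adj Cd] after [adj C]. *)
have F_le y : nrm (F y) <= M3 * nrm (adj B2 y - P (adj B2 y)).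
  by rewrite -CadjE /F -CCdadj adj_comp; exact: hM3.
have [M4 [M40 hM4]] := adjop_bounded (adj C).
split=> //.
- exists (c * (1 + M2 * M) + M) => //.
  by rewrite addr_gt0 // mulr_gt0 // addr_gt0 // mulr_gt0.
- have [M5 [M50 hM5]] := adjop_bounded (1 - P).
  have [||_ [X hX]] := @mpinv_lower_bound _ _ _ _ (adj B2) F (M3 * M5) _ CCdadj B2F.
  + by rewrite mulr_gt0.
  + move=> y; apply: le_trans (F_le y) _; rewrite -mulrA ler_pM2l //.
    exact: hM5.
  + by exists (adj X); have := is_mpinv_adj hX; rewrite adjK.
- have [M5 [M50 hM5]] := adjop_bounded (adj B2).
  exists (M5 * M3); first exact: mulr_gt0.
  move=> y; rewrite -{1}B2F -mulrA; apply: le_trans (hM5 _) _.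
  by rewrite ler_pM2l.
Qed.

End SeparatedPair.

(** * Weighted sums and the perturbation estimate *)

Section Weighted.
Variables (R : realType) (Alg : cstarAlgType R) (H K E : hilbertModType Alg).

(** The weights and the root of t are absorbed into the two operators, so the support N is the same
    for all weights and all t > 0. *)
Lemma mpinv_weighted (A : 'L(H, K)) (B : 'L(H, E)) (V : 'L(K)) (W : 'L(E))
    (N : 'L(H)) c t : op_posdef V -> op_posdef W -> 0 < c -> 0 < t ->
  adj N = N -> (forall x, A (N x) = A x) -> (forall x, B (N x) = B x) ->
  (forall x, nrm (N x) <= c * (nrm (A x) + nrm (B x))) ->
  exists X, let G := (adj A * V * A + t%:C *: (adj B * W * B))%op in
    [/\ is_mpinv G X, (X * G)%op = N & (G * X)%op = N].
Proof.
move=> /posdef_sqrt[Sv [v [v0 -> hv]]] /posdef_sqrt[Sw [w [w0 -> hw]]] c0 t0.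
move=> Nadj AN BN hN.
pose s := Num.sqrt t.
have s0 : 0 < s by rewrite sqrtr_gt0.
have st : s * s = t by rewrite -expr2 sqr_sqrtr // ltW.
pose T := (Sv * A)%op; pose S := s%:C *: (Sw * B)%op.
have [|//||||X hX] := @mpinv_sum_adjM _ _ H K E T S N (c * (v + w / s)).
- by rewrite mulr_gt0 // addr_gt0 // divr_gt0.
- by move=> x; rewrite /= AN.
- by move=> x; rewrite /= BN.
- move=> x; apply: le_trans (hN x) _; rewrite -mulrA ler_pM2l //.
  have h1 := hv (A x); have h2 := hw (B x).
  rewrite /= nrmZr; last exact: ltW.
  have := nrm_ge0 (Sv (A x)); have := nrm_ge0 (Sw (B x)).
  move: h1 h2; set a := nrm (A x); set b := nrm (B x); set a' := nrm _.
  set b' := nrm _ => h1 h2 b0 a0.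
  have -> : (v + w / s) * (a' + s * b') = v * a' + w * b' + (v * (s * b') + w / s * a').
    by field; rewrite gt_eqF.
  have : 0 <= v * (s * b') by rewrite !mulr_ge0 // ltW.
  have : 0 <= w / s * a' by rewrite mulr_ge0 // divr_ge0 // ltW.
  lra.
exists X => /=.
have <- : (adj T * T + adj S * S)%op =
    (adj A * (adj Sv * Sv) * A + t%:C *: (adj B * (adj Sw * Sw) * B))%op.
  by rewrite /S adjM_scale st /T !adj_comp; exact: adjopP.
exact: hX.
Qed.

(** In the pairing, P moves from the right-hand side onto D k, where A controls it: the form is O(t
    |A D k| |k|). Its A-part bounds |A D k|, and this in turn feeds the bound of its B-part. *)
Lemma perturbation_bound (A : 'L(H, K)) (B : 'L(H, E)) (V : 'L(K)) (W : 'L(E))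
    (P N : 'L(H)) (Q : 'L(K, H)) c M : op_posdef V -> op_posdef W -> 0 < c -> 0 < M ->
  adj P = P -> (forall x, nrm (P x) <= M * nrm (A x)) ->
  (forall x, nrm (N x) <= c * (nrm (A x) + nrm (B x))) ->
  exists2 C, 0 <= C & forall t (D : 'L(K, H)), 0 < t <= 1 ->
    (forall k, N (D k) = D k) ->
    (forall k, (adj A * V * A + t%:C *: (adj B * W * B))%op (D k) =
       - (t%:C *: P (Q k))) ->
    bdd D (C * Num.sqrt t).
Proof.
move=> /posdef_sqrt[Sv [v [v0 -> hv]]] /posdef_sqrt[Sw [w [w0 -> hw]]] c0 M0.
move=> Padj PA hN.
have [q [q0 hq]] := adjop_bounded Q.
pose k1 := 4 * v ^+ 2 * M * q; pose k2 := 4 * w ^+ 2 * M * q.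
have k10 : 0 < k1 by rewrite !mulr_gt0 // exprn_gt0.
have k20 : 0 < k2 by rewrite !mulr_gt0 // exprn_gt0.
exists (c * (k1 + (k1 + k2))); first by rewrite mulr_ge0 // ltW // !addr_gt0.
move=> t D /andP[t0 t1] ND GD k.
pose s := Num.sqrt t.
have s0 : 0 < s by rewrite sqrtr_gt0.
have st : s ^+ 2 = t by rewrite sqr_sqrtr // ltW.
have s1 : s <= 1 by nra.
pose I := inner (D k) ((adj A * (adj Sv * Sv) * A +
   t%:C *: (adj B * (adj Sw * Sw) * B))%op (D k)).
have IE : I = inner (Sv (A (D k))) (Sv (A (D k))) +
    inner (s%:C *: Sw (B (D k))) (s%:C *: Sw (B (D k))).
  rewrite /I /= innerDr innerZr innerZl innerZr conj_realC scalerA -rmorphM /=.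
  by rewrite -expr2 st -!adjopE.
have hI : nrm I <= t * (4 * (M * nrm (A (D k))) * (q * nrm k)).
  rewrite /I GD innerNr nrmN innerZr nrmZr; last exact: ltW.
  rewrite ler_pM2l // inner_adjr Padj; apply: le_trans (nrm_inner_le _ _) _.
  by rewrite ler_pM ?mulr_ge0 ?nrm_ge0 // ler_pM2l.
have hIa : nrm (Sv (A (D k))) ^+ 2 <= nrm I.
  by rewrite IE -nrm_inner; apply: nrm_le_aposD; exact: apos_inner.
have hIb : t * nrm (Sw (B (D k))) ^+ 2 <= nrm I.
  rewrite IE -st -exprMn -nrmZr; last exact: ltW.
  by rewrite -nrm_inner; apply: nrm_le_aposDr; exact: apos_inner.
have ha := hv (A (D k)); have hb := hw (B (D k)).
rewrite -ND; apply: le_trans (hN _) _.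
have := nrm_ge0 (Sv (A (D k))); have := nrm_ge0 (Sw (B (D k))).
have := nrm_ge0 (A (D k)); have := nrm_ge0 (B (D k)); have := nrm_ge0 k.
move: hI hIa hIb ha hb.
set i := nrm I; set a := nrm (A _); set b := nrm (B _); set n := nrm k.
set a' := nrm (Sv _); set b' := nrm (Sw _).
move=> hI hIa hIb ha hb n0 b0 a0 b'0 a'0.
have ha2 : a ^+ 2 <= a * (k1 * t * n).
  have h1 : a ^+ 2 <= (v * a') ^+ 2 by rewrite ler_sqr // nnegrE mulr_ge0 // ltW.
  have h2 : v ^+ 2 * a' ^+ 2 <= v ^+ 2 * (t * (4 * (M * a) * (q * n))).
    by rewrite ler_pM2l ?exprn_gt0 //; exact: le_trans hIa hI.
  rewrite exprMn in h1; apply: le_trans h1 _; apply: le_trans h2 _.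
  by rewrite /k1 le_eqVlt; apply/orP; left; apply/eqP; ring.
have ha3 : a <= k1 * t * n.
  move: a0; rewrite le_eqVlt => /predU1P[<-|a0]; last by rewrite -(ler_pM2l a0) -expr2.
  by rewrite !mulr_ge0 // ltW.
have hb2 : b ^+ 2 <= k2 * a * n.
  have h1 : b ^+ 2 <= (w * b') ^+ 2 by rewrite ler_sqr // nnegrE mulr_ge0 // ltW.
  have h2 : b' ^+ 2 <= 4 * (M * a) * (q * n).
    by rewrite -(ler_pM2l t0); exact: le_trans hIb hI.
  have h3 : w ^+ 2 * b' ^+ 2 <= w ^+ 2 * (4 * (M * a) * (q * n)).
    by rewrite ler_pM2l ?exprn_gt0.
  rewrite exprMn in h1; apply: le_trans h1 _; apply: le_trans h3 _.
  by rewrite /k2 le_eqVlt; apply/orP; left; apply/eqP; ring.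
have hb3 : b ^+ 2 <= ((k1 + k2) * s * n) ^+ 2.
  apply: le_trans hb2 _.
  have h1 : k2 * a * n <= k2 * (k1 * t * n) * n by rewrite ler_wpM2r // ler_pM2l.
  apply: le_trans h1 _; rewrite -st.
  have -> : ((k1 + k2) * s * n) ^+ 2 =
     k2 * (k1 * s ^+ 2 * n) * n + (k1 ^+ 2 + k1 * k2 + k2 ^+ 2) * (s * n) ^+ 2 by ring.
  rewrite lerDl mulr_ge0 ?sqr_ge0 // !addr_ge0 ?sqr_ge0 // mulr_ge0 // ltW //.
have hb4 : b <= (k1 + k2) * s * n.
  by rewrite -ler_sqr // nnegrE !mulr_ge0 ?addr_ge0 // ltW.
(* t <= s because s <= 1; this weakens the rate to that of [b]. *)
have ha4 : a <= k1 * s * n.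
  apply: le_trans ha3 _; rewrite ler_wpM2r // ler_pM2l // -st expr2.
  by rewrite -[leRHS]mulr1 ler_pM2l.
have -> : c * (k1 + (k1 + k2)) * s * n = c * (k1 * s * n + (k1 + k2) * s * n) by ring.
by rewrite ler_pM2l // lerD.
Qed.

End Weighted.

(** * The limit formula *)

Local Open Scope adjop_scope.

Theorem theorem3p24 (R : realType) (Alg : cstarAlgType R)
    (H K E : hilbertModType Alg) (A : 'L(H, K)) (B : 'L(H, E))
    (A_mp : mp_invertible A)
    (AB_mp : mp_invertible (A^* * A + B^* * B))
    (V : 'L(K)) (W W' : 'L(E))
    (V_pd : op_posdef V) (W_pd : op_posdef W) (W'_pd : op_posdef W')
    (B1 B2 : 'L(H, E)) (B12 : B = B1 + B2)
    (B12_orth : B2^* * W * B1 = 0%R)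
    (B1_range : range (B1^*) `<=` range (A^*))
    (AB2_sep : separated_pair (range (A^*)) (range (B2^*))) :
  (* the inverses in the formulas below exist *)
  [/\ forall t : R, (0 < t)%R ->
        mp_invertible (A^* * V * A + t%:C *: (B^* * W * B)),
      mp_invertible (A^* * V * A + B2^* * W' * B2),
      mp_invertible (A^* * V * A),
      mp_invertible B2 &
      op_invertible (2%:R *: opid H - A^† * A - B2^† * B2)] /\
  let Pi' : 'L(K, H) :=
    (2%:R *: opid H - A^† * A - B2^† * B2)^-1 * (A^* * V * A)^† * A^* * V in
  let L : 'L(K, H) := (A^* * V * A + B2^* * W' * B2)^† * A^* * V in
  opnorm ((A^* * V * A + t%:C *: (B^* * W * B))^† * A^* * V - L)
    @[t --> (0 : R)^'+] --> 0%E /\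
  L = (A^* * V * A)^† * A^* * V - (opid H - A^† * A) * Pi'.
Proof.
subst B.
have [N [c [c0 Nadj AN BN hN]]] := range_sum_projection AB_mp.
have AB2_inter : range (A^*) `&` range (B2^*) = [set 0] by case: AB2_sep.
have [B1P B2N [c' c'0 hN'] B2_mp [d d0 hB2]] :=
  separated_pair_bounds A_mp B1_range AB2_inter c0 Nadj AN BN hN.
have [Padj AP PP PA Pran] := mp_projection A_mp.
have [Qadj B2Q QQ QB2 Qran] := mp_projection B2_mp.
have [M [M0 hM]] := adjop_bounded (mpinv A).
have hP x : (nrm ((mpinv A * A)%op x) <= M * nrm (A x))%R := hM (A x).
have PN x : (mpinv A * A)%op (N x) = (mpinv A * A)%op x by rewrite /= AN.
have QN x : (mpinv B2 * B2)%op (N x) = (mpinv B2 * B2)%op x by rewrite /= B2N.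
have B20 x : (mpinv B2 * B2)%op x = 0 -> B2 x = 0 by move=> h; rewrite -B2Q h op0.
move: B1P hB2 Padj AP PP PA Pran Qadj B2Q QQ QB2 Qran hP PN QN B20.
set P := (mpinv A * A)%op; set Q := (mpinv B2 * B2)%op; clearbody P Q.
move=> B1P hB2 Padj AP PP PA _ Qadj B2Q QQ QB2 Qran hP PN QN B20.
have U_inv : op_invertible (2%:R *: opid H - P - Q).
  apply: (is_opinv_two_sub_projections d0) => // x.
  by have [y ->] := Qran x.
have hG0 : exists X, [/\ is_mpinv (A^* * V * A) X,
    X * (A^* * V * A) = P & (A^* * V * A) * X = P].
  have [S [s [s0 VE hS]]] := posdef_sqrt V_pd.
  have -> : A^* * V * A = (S * A)^* * (S * A) by rewrite VE adj_comp; exact: adjopP.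
  have [||||[X hX] _] // := @mpinv_lower_bound _ _ _ _ (S * A) P (M * s)%R.
  - exact: mulr_gt0.
  - by move=> x; rewrite /= AP.
  - move=> x; apply: le_trans (hP x) _; rewrite -mulrA ler_pM2l //; exact: hS.
  - by exists X.
have [X0 [X0mp X0G GX0]] := hG0.
have hGt t : 0 < t -> exists X, let G := A^* * V * A + t%:C *: (((B1 + B2)^* * W * (B1 + B2))) in
    [/\ is_mpinv G X, X * G = N & G * X = N].
  by move=> t0; exact: (mpinv_weighted V_pd W_pd c0 t0 Nadj AN BN hN).
have [X2 [X2mp X2G GX2]] : exists X, let G := A^* * V * A + B2^* * W' * B2 in
    [/\ is_mpinv G X, X * G = N & G * X = N].
  have := mpinv_weighted V_pd W'_pd c'0 ltr01 Nadj AN B2N hN'.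
  by rewrite scale1r.
split.
  split=> //.
  - by move=> t t0; have [X [hX _ _]] := hGt t t0; exists X.
  - by exists X2.
  - by exists X0.
have [Y UY] := U_inv.
rewrite (opinv_eq UY) (mpinv_eq X2mp) (mpinv_eq X0mp) => Pi' L.
have [YU UYid] := UY.
pose Z := X0 * A^* * V - (opid H - P) * Pi'.
pose L0 k := X0 (adj A (V k)).
have vY1 x : Y (x *+ 2 - P x - Q x) = x.
  by have := congr1 (fun T : 'L(H) => T x) YU; rewrite /= scaler_nat.
have vY2 x : Y x *+ 2 - P (Y x) - Q (Y x) = x.
  by have := congr1 (fun T : 'L(H) => T x) UYid; rewrite /= scaler_nat.
have ZE k : Z k = L0 k - (Y (L0 k) - P (Y (L0 k))) by [].
have NP x : N (P x) = P x.
  by apply: inner_ext => y; rewrite (inner_adjr N) Nadj !(inner_adjr P) Padj PN.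
have NQ x : N (Q x) = Q x.
  by apply: inner_ext => y; rewrite (inner_adjr N) Nadj !(inner_adjr Q) Qadj QN.
have NA y : N (adj A y) = adj A y by rewrite -PA NP.
(* N commutes with P and Q, hence with 2 - P - Q and its inverse. *)
have NY x : N (Y x) = Y (N x).
  rewrite -[LHS]vY1; congr (Y _); rewrite -[in RHS](vY2 x).
  by rewrite !opB mulr2n opD PN QN NP NQ -mulr2n.
have PX0 x : P (X0 x) = X0 x.
  by have [_ XGX _ _] := X0mp; rewrite -[in RHS]XGX X0G.
have PL0 k : P (L0 k) = L0 k by exact: PX0.
have GL0 k : adj A (V (A (L0 k))) = adj A (V k).
  by have := congr1 (fun T : 'L(H) => T (adj A (V k))) GX0; rewrite PA.
have PZ k : P (Z k) = L0 k by rewrite ZE !(opB P) PP subrr subr0 PL0.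
have NZ k : N (Z k) = Z k.
  by rewrite ZE !(opB N) NP NY -PL0 NP.
(* With y = Y (L0 k), the equation L0 k = 2 y - P y - Q y turns Z k into y - Q y, which Q kills. *)
have B2Z k : B2 (Z k) = 0.
  apply: B20; rewrite ZE !(opB Q) -{1}(vY2 (L0 k)) !(opB Q) mulr2n (opD Q) QQ.
  set a := Q (Y _); set b := Q (P _).
  by rewrite -(addrA a a) (addrC a (a - b)%R) addrK subrr.
have AZ k : A (Z k) = A (L0 k) by rewrite -AP PZ.
have G2Z k : (A^* * V * A + B2^* * W' * B2) (Z k) = adj A (V k).
  have -> : (A^* * V * A + B2^* * W' * B2) (Z k) =
    (adj A (V (A (Z k))) + adj B2 (W' (B2 (Z k))))%R by [].
  by rewrite B2Z AZ GL0 !op0 addr0.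
have LZ : L = Z.
  apply: adjopP => k; rewrite -[LHS]/(X2 (adj A (V k))) -G2Z.
  by rewrite -[LHS]/((X2 * (A^* * V * A + B2^* * W' * B2)) (Z k)) X2G NZ.
split; last exact: LZ.
(* On Z the operator B acts as B1 after [L0], and the weighted orthogonality removes the B2^* part
   of B^* W B Z. What remains lies in the range of B1^*, which P fixes. *)
pose Qr : 'L(K, H) := B1^* * W * B1 * X0 * A^* * V.
have PB1 y : P (adj B1 y) = adj B1 y.
  by apply: inner_ext => x; rewrite (inner_adjr P) Padj !(inner_adjr (adj B1)) adjK B1P.
have [C C0 hC] := perturbation_bound Qr V_pd W_pd c0 M0 Padj hP hN.
have hD t : (0 < t <= 1)%R ->
    bdd ((A^* * V * A + t%:C *: ((B1 + B2)^* * W * (B1 + B2)))^† * A^* * V - L)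
      (C * Num.sqrt t)%R.
  move=> t01; have /andP[t0 _] := t01.
  have [X [Xmp XG GX]] := hGt t t0.
  rewrite (mpinv_eq Xmp) LZ.
  set G := (X in is_mpinv X _) in Xmp XG GX.
  pose D := X * A^* * V - Z.
  have DE k : D k = (X (adj A (V k)) - Z k)%R by [].
  have GZ k : G (Z k) = (adj A (V k) + t%:C *: P (Qr k))%R.
    have -> : G (Z k) = (adj A (V (A (Z k))) +
        t%:C *: (adj B1 (W (B1 (Z k) + B2 (Z k))) +
                 adj B2 (W (B1 (Z k) + B2 (Z k)))))%R by [].
    rewrite AZ GL0 B2Z addr0 -(B1P (Z k)) PZ PB1.
    have -> : adj B2 (W (B1 (L0 k))) = 0%R.
      by have := congr1 (fun T : 'L(H) => T (L0 k)) B12_orth.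
    by rewrite addr0.
  apply: (hC t D) => // k.
    have [_ XGX _ _] := Xmp.
    by rewrite DE (opB N) NZ -[in RHS]XGX XG.
  have GXv v : G (X v) = N v by have := congr1 (fun T : 'L(H) => T v) GX.
  change (G (D k) = - (t%:C *: P (Qr k)))%R.
  by rewrite DE opB GXv NA GZ opprD addrA subrr add0r.
(* The bound holds for 0 < t <= 1, which is eventually true on the right of 0. *)
apply: (@squeeze_cvge _ _ _ _ (cst 0%E) _ (fun t : R => (C * Num.sqrt t)%:E)).
- near=> t; rewrite opnorm_ge0 /=; apply: opnorm_le; first by rewrite mulr_ge0 ?sqrtr_ge0.
  apply: hD; apply/andP; split; near: t.
    exact: nbhs_right_gt.
  exact: nbhs_right_le.
- exact: cvg_cst.
- have -> : 0%E = (C * Num.sqrt 0)%:E :> \bar R by rewrite sqrtr0 mulr0.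
  apply: cvg_EFin; first by near=> t.
  apply: cvg_at_right_filter; apply: cvgM; first exact: cvg_cst.
  exact: sqrt_continuous.
Unshelve. all: by end_near.
Qed.
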